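(* Let $d\geq 1$ and $p\geq 2$ be any integers and let $R$ be any countable group. Let $G_1\leqslant G_2\leqslant \dots$ be an infinite ascending chain of groups such that the following conditions hold for all $n \ge 1$: (1) $G_n$ is finitely generated and perfect; (2) $G_n/Z(G_n)$ is simple, and there is an isomorphism $\psi_n\colon Z(G_n)\to \mathbf{Z}^d$; (3) $Z(G_{n+1})\leqslant Z(G_n)$ and $\psi_n(Z(G_{n+1}))=p\mathbf{Z}^d$; (4) $C_{G_n}(G_1)=Z(G_1)$; (5) $R$ is a subgroup of $G_1$, with $R\cap Z(G_1)=\{1\}$; (6) if $R$ is torsion-free then so is $G_n$; and such that the group $G_\infty=\bigcup_{n\ge 1} G_n$ is simple. Then the topological group $\mathcal G=\mathrm{Linn}(G_\infty)=\overline{\mathrm{Inn}(G_\infty)}$ has the following properties. (i) $\mathcal G$ is non-abelian, locally compact, totally disconnected, non-discrete and topologically simple. (ii) $\mathcal G$ is not abstractly simple; every non-trivial normal subgroup of $\mathcal G$ contains $\mathrm{Inn}(G_\infty)$. (iii) The closure of the image of $Z(G_1)$ in $\mathcal G$ is a compact open subgroup isomorphic to $\mathbf{Z}_{p_1}^d\times\dots\times\mathbf{Z}_{p_t}^d$, where $p_1<p_2<\dots<p_t$ denote the distinct prime divisors of $p$. (iv) $R$ is embedded as a discrete subgroup in $\mathcal G$ (via the natural homomorphism $G_\infty\to\mathcal G$). (v) $\mathcal G$ is second countable, but not compactly generated. (vi) For each $n$, the closure of the image of $Z(G_n)$ in $\mathcal G$ is open, and coincides with $C_{\mathcal G}(G_n)$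 (the centralizer in $\mathcal G$ of the image of $G_n$). (vii) For each $m\geq 1$ and each Hausdorff topological field $F$, the only continuous homomorphism $\mathcal G\to\mathrm{GL}_m(F)$ is the trivial one. (viii) Every finitely generated centerless subgroup of $\mathcal G$ is discrete. (ix) The finitely generated centerless subgroups of $\mathcal G$ fall into countably many abstract isomorphism classes.
   Context: $Z(G)$ denotes the center of $G$ and $C_G(S)$ the centralizer of a subset $S$ in $G$. A group is perfect if it equals its derived subgroup. $\mathbf{Z}_q$ denotes the additive topological group of $q$-adic integers. For a discrete group $G$, the automorphism group $\mathrm{Aut}(G)$ is endowed with the topology of pointwise convergence for its action on the discrete set $G$ (the Braconnier topology); a basis of identity neighborhoods is given by the pointwise stabilizers of finite subsets of $G$. $\mathrm{Inn}(G)$ is the group of inner automorphisms, and $\mathrm{Linn}(G)=\overline{\mathrm{Inn}(G)}$ is its closure in $\mathrm{Aut}(G)$, with the induced topology. Conjugation gives a natural homomorphism $G\to\mathrm{Linn}(G)$, and ''the image in $\mathcal G$'' of a subgroup of $G_\infty$ refers to this homomorphism, where $G_\infty$ is regarded as a discrete group. A topological group is topologically simple if it is non-trivial and has no non-trivial proper closed normal subgroups; it is abstractly simple if it is simple as an abstract group. It is compactly generated if it is generated by a compact subset. A group is centerless if its center is trivial. Abstract isomorphism classes are isomorphism classes of groups, ignoring the topologies. *)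

(* Defs.v *)
From HB Require Import structures.
From mathcomp Require Import all_boot all_order all_algebra.
From mathcomp Require Import all_classical topology tvs.

Set Implicit Arguments.
Unset Strict Implicit.
Unset Printing Implicit Defensive.

Local Open Scope classical_set_scope.
Local Open Scope group_scope.

Section SubsetsOfGroups.
Variable G : groupType.
Implicit Types A B N S : set G.

Definition is_subgroup A := A 1 /\ forall x y, A x -> A y -> A (x / y).

Definition is_normal_subgroup N :=
  is_subgroup N /\ forall x y, N x -> N (x ^ y).

Definition generated S : set G := smallest is_subgroup S.

Definition finitely_generated A :=
  exists2 S : set G, finite_set S & generated S = A.

Definition centralizer A B : set G :=
  [set x | A x /\ forall y, B y -> commute x y].

Definition center A : set G := centralizer A A.

Definition centerless A := center A = [set 1].

Definition derived A : set G :=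
  generated [set z | exists x y, [/\ A x, A y & z = [~ x, y]]].

Definition perfect A := derived A = A.

Definition torsion_free A :=
  forall x n, A x -> (0 < n)%N -> x ^+ n = 1 -> x = 1.

End SubsetsOfGroups.

Definition simple_group (G : groupType) :=
  [set: G] <> [set 1] /\
  forall N : set G, is_normal_subgroup N -> N = [set 1] \/ N = [set: G].

Definition isomorphic (G H : groupType) :=
  exists f : {multiplicative G -> H}, bijective f.

(* A subgroup coerces to its carrier set, and, through [set_type], to a type;
   that type is a group, and carries the subspace topology whenever the ambient
   group is a topological space. *)
Record subgroup (G : groupType) := Subgroup {
  subgroup_set :> set G;
  subgroupP : is_subgroup subgroup_set
}.

Section SubgroupType.
Variables (G : groupType) (H : subgroup G).
Local Notation T := (set_type (subgroup_set H)).

Lemma subgroup1 : 1 \in subgroup_set H.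
Proof. by apply/mem_set; case: (subgroupP H). Qed.

Lemma subgroupV x : x \in subgroup_set H -> x^-1 \in subgroup_set H.
Proof.
move=> /set_mem Hx; apply/mem_set; rewrite -[x^-1]div1g.
by apply: (subgroupP H).2 => //; case: (subgroupP H).
Qed.

Lemma subgroupM x y :
  x \in subgroup_set H -> y \in subgroup_set H -> x * y \in subgroup_set H.
Proof.
move=> /set_mem Hx /subgroupV/set_mem Hy; apply/mem_set.
by rewrite -[y]invgK; apply: (subgroupP H).2.
Qed.

Definition subgroup_one : T := exist _ 1 subgroup1.
Definition subgroup_inv (x : T) : T :=
  exist _ (sval x)^-1 (subgroupV (svalP x)).
Definition subgroup_mul (x y : T) : T :=
  exist _ (sval x * sval y) (subgroupM (svalP x) (svalP y)).

Fact subgroup_mulA : associative subgroup_mul.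
Proof. by move=> x y z; apply: val_inj; rewrite /= mulgA. Qed.
Fact subgroup_mul1g : left_id subgroup_one subgroup_mul.
Proof. by move=> x; apply: val_inj; rewrite /= mul1g. Qed.
Fact subgroup_mulg1 : right_id subgroup_one subgroup_mul.
Proof. by move=> x; apply: val_inj; rewrite /= mulg1. Qed.
Fact subgroup_mulVg : left_inverse subgroup_one subgroup_inv subgroup_mul.
Proof. by move=> x; apply: val_inj; rewrite /= mulVg. Qed.
Fact subgroup_mulgV : right_inverse subgroup_one subgroup_inv subgroup_mul.
Proof. by move=> x; apply: val_inj; rewrite /= mulgV. Qed.

HB.instance Definition _ := isGroup.Build T subgroup_mulA subgroup_mul1g
  subgroup_mulg1 subgroup_mulVg subgroup_mulgV.

End SubgroupType.

Record normal_subgroup (G : groupType) := NormalSubgroup {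
  normal_set :> set G;
  normal_subgroupP : is_normal_subgroup normal_set
}.

Section Quotient.
Variables (G : groupType) (N : normal_subgroup G).
Local Open Scope quotient_scope.

Let N1 : normal_set N 1. Proof. by case: (normal_subgroupP N) => -[]. Qed.
Let NF x y : normal_set N x -> normal_set N y -> normal_set N (x / y).
Proof. by case: (normal_subgroupP N) => -[_ NF] _; exact: NF. Qed.
Let NJ x y : normal_set N x -> normal_set N (x ^ y).
Proof. by case: (normal_subgroupP N) => _; apply. Qed.
Let NV x : normal_set N x -> normal_set N x^-1.
Proof. by move=> /(NF N1); rewrite div1g. Qed.
Let NM x y : normal_set N x -> normal_set N y -> normal_set N (x * y).
Proof. by move=> Nx /NV; rewrite -{2}[y]invgK; exact: NF. Qed.

Definition same_coset (x y : G) : bool := `[< normal_set N (x^-1 * y) >].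

Fact same_coset_refl : reflexive same_coset.
Proof. by move=> x; apply/asboolP; rewrite mulVg. Qed.
Fact same_coset_sym : symmetric same_coset.
Proof.
by move=> x y; apply/asboolP/asboolP => /NV; rewrite invgM invgK.
Qed.
Fact same_coset_trans : transitive same_coset.
Proof.
move=> y x z /asboolP xy /asboolP yz; apply/asboolP.
by have := NM xy yz; rewrite -mulgA mulVKg.
Qed.

Canonical same_coset_equiv :=
  EquivRel same_coset same_coset_refl same_coset_sym same_coset_trans.

Definition quotient_group := {eq_quot same_coset}.
HB.instance Definition _ := Choice.on quotient_group.
HB.instance Definition _ := EqQuotient.on quotient_group.

Implicit Types X Y : quotient_group.

Definition quotient_pi (x : G) : quotient_group := \pi_quotient_group x.
Definition quotient_one := quotient_pi 1.
Definition quotient_inv X := quotient_pi (repr X)^-1.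
Definition quotient_mul X Y := quotient_pi (repr X * repr Y).

Lemma quotient_piP (x y : G) :
  quotient_pi x = quotient_pi y <-> normal_set N (x^-1 * y).
Proof. by split=> [/eqmodP/asboolP|?] //; apply/eqmodP/asboolP. Qed.

Lemma quotient_repr (x : G) : normal_set N ((repr (quotient_pi x))^-1 * x).
Proof. by apply/quotient_piP; rewrite /quotient_pi reprK. Qed.

Lemma quotient_mulE (x y : G) :
  quotient_mul (quotient_pi x) (quotient_pi y) = quotient_pi (x * y).
Proof.
apply/quotient_piP; set a := repr _; set b := repr _.
have Na : normal_set N (a^-1 * x) by exact: quotient_repr.
have Nb : normal_set N (b^-1 * y) by exact: quotient_repr.
have -> : (a * b)^-1 * (x * y) = (b^-1 * y) * ((a^-1 * x) ^ y).
  by rewrite conjgE invgM !mulgA mulgK.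
exact/NM/NJ.
Qed.

Lemma quotient_invE (x : G) : quotient_inv (quotient_pi x) = quotient_pi x^-1.
Proof.
apply/quotient_piP; set a := repr _; rewrite invgK.
have /NV : normal_set N (a^-1 * x) by exact: quotient_repr.
by rewrite invgM invgK => /(NJ a^-1); rewrite conjgE invgK mulgK.
Qed.

Lemma quotient_ind (P : quotient_group -> Prop) :
  (forall x, P (quotient_pi x)) -> forall X, P X.
Proof. by move=> Ppi X; rewrite -[X]reprK; exact: Ppi. Qed.

Fact quotient_mulA : associative quotient_mul.
Proof.
by elim/quotient_ind=> x; elim/quotient_ind=> y; elim/quotient_ind=> z; rewrite !quotient_mulE mulgA.
Qed.
Fact quotient_mul1g : left_id quotient_one quotient_mul.
Proof. by elim/quotient_ind=> x; rewrite quotient_mulE mul1g. Qed.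
Fact quotient_mulg1 : right_id quotient_one quotient_mul.
Proof. by elim/quotient_ind=> x; rewrite quotient_mulE mulg1. Qed.
Fact quotient_mulVg : left_inverse quotient_one quotient_inv quotient_mul.
Proof. by elim/quotient_ind=> x; rewrite quotient_invE quotient_mulE mulVg. Qed.
Fact quotient_mulgV : right_inverse quotient_one quotient_inv quotient_mul.
Proof. by elim/quotient_ind=> x; rewrite quotient_invE quotient_mulE mulgV. Qed.

HB.instance Definition _ := isGroup.Build quotient_group quotient_mulA
  quotient_mul1g quotient_mulg1 quotient_mulVg quotient_mulgV.

End Quotient.

Lemma center_normal (G : groupType) : is_normal_subgroup (center [set: G]).
Proof.
split=> [|x y [_ cx]].
  split; first by split=> // y _; exact/commute_sym/commute1.
  move=> x y [_ cx] [_ cy]; split=> // z _.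
  apply: commute_sym; apply: commuteM; first exact/commute_sym/cx.
  by apply: commuteV; apply/commute_sym/cy.
by rewrite (_ : x ^ y = x) // /conjg cx // mulKg.
Qed.

Definition center_group (G : groupType) : normal_subgroup G :=
  NormalSubgroup (center_normal G).

Definition discrete_space (T : topologicalType) := forall A : set T, open A.

HB.mixin Record isTopologicalGroup G & Topological G & Group G := {
  mulg_continuous : continuous (fun x : G * G => x.1 * x.2);
  invg_continuous : continuous (fun x : G => x^-1)
}.

#[short(type="topologicalGroupType")]
HB.structure Definition TopologicalGroup :=
  {G of Topological G & Group G & isTopologicalGroup G}.

HB.mixin Record isTopologicalField F & Topological F & GRing.Field F := {
  mulf_continuous : continuous (fun x : F * F => (x.1 * x.2)%R);
  invf_continuous :
    forall x : F, (x != 0)%R -> {for x, continuous (fun y : F => y^-1%R)}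
}.

#[short(type="topologicalFieldType")]
HB.structure Definition TopologicalField :=
  {F of TopologicalZmodule F & GRing.Field F & isTopologicalField F}.

Section SubgroupTopology.
Variables (G : topologicalGroupType) (H : subgroup G).
Local Notation T := (set_type (subgroup_set H)).

Fact subgroup_val_continuous : continuous (set_val : T -> G).
Proof. exact: initial_continuous. Qed.

Fact subgroup_mul_continuous : continuous (fun x : T * T => x.1 * x.2).
Proof.
apply: continuous_comp_initial => x.
apply: (@continuous_comp _ _ _ (fun x : T * T => (set_val x.1, set_val x.2))
  (fun y : G * G => y.1 * y.2)); last exact: mulg_continuous.
by apply: cvg_pair; apply: continuous_comp;
  [exact: cvg_fst | exact: subgroup_val_continuous |
   exact: cvg_snd | exact: subgroup_val_continuous].
Qed.

Fact subgroup_inv_continuous : continuous (fun x : T => x^-1).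
Proof.
apply: continuous_comp_initial => x.
apply: (@continuous_comp _ _ _ (set_val : T -> G) (fun y : G => y^-1)).
  exact: subgroup_val_continuous.
exact: invg_continuous.
Qed.

HB.instance Definition _ := isTopologicalGroup.Build T
  subgroup_mul_continuous subgroup_inv_continuous.

Lemma closure_is_subgroup : is_subgroup (closure (subgroup_set H)).
Proof.
case: (subgroupP H) => H1 HF; split; first exact: subset_closure.
move=> x y clx cly B nB.
have cF : {for (x, y), continuous (fun z : G * G => z.1 / z.2)}.
  apply: (@continuous_comp _ _ _ (fun z : G * G => (z.1, z.2^-1))
    (fun z : G * G => z.1 * z.2)); last exact: mulg_continuous.
  apply: cvg_pair; first exact: cvg_fst.
  by apply: continuous_comp; [exact: cvg_snd | exact: invg_continuous].
have [[P Q] /= [nP nQ] sPQ] := cF B nB.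
have [a [Ha Pa]] := clx _ nP; have [b [Hb Qb]] := cly _ nQ.
by exists (a / b); split; [exact: HF | exact: (sPQ (a, b))].
Qed.

Definition closure_group : subgroup G := Subgroup closure_is_subgroup.

End SubgroupTopology.

(* [{ptws G -> discrete_topology G}] is the space of all maps G -> G with the
   topology of pointwise convergence, the target being discrete. *)
Definition automorphisms (G : groupType) : set {ptws G -> discrete_topology G} :=
  [set f : G -> G | {morph f : x y / x * y} /\ bijective f].

Definition aut (G : groupType) : Type := set_type (@automorphisms G).
HB.instance Definition _ (G : groupType) :=
  Topological.copy (aut G) (set_type (@automorphisms G)).

Section Automorphisms.
Variable G : groupType.

Definition aut_fun (f : aut G) : G -> G := sval f.
Coercion aut_fun : aut >-> Funclass.

Lemma autM (f : aut G) : {morph aut_fun f : x y / x * y}.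
Proof. by case: f => f /= /set_mem []. Qed.

Lemma aut_bij (f : aut G) : bijective (aut_fun f).
Proof. by case: f => f /= /set_mem []. Qed.

Lemma aut_inj (f : aut G) : injective (aut_fun f).
Proof. exact: bij_inj (aut_bij f). Qed.

Definition mkaut (f : G -> G) (fM : {morph f : x y / x * y})
  (fB : bijective f) : aut G :=
  exist _ (f : {ptws G -> discrete_topology G}) (mem_set (conj fM fB)).

Lemma autP (f g : aut G) : f =1 g -> f = g.
Proof. by move=> fg; apply: val_inj; apply/funext. Qed.

Fact aut_preimage (f : aut G) (y : G) : exists x, f x == y.
Proof. by have [g _ gK] := aut_bij f; exists (g y); rewrite gK. Qed.

Definition aut_inv_fun (f : aut G) (y : G) : G := xchoose (aut_preimage f y).

Fact aut_inv_funK (f : aut G) : cancel (aut_inv_fun f) (aut_fun f).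
Proof. by move=> y; apply/eqP; exact: xchooseP (aut_preimage f y). Qed.

Fact aut_funK (f : aut G) : cancel (aut_fun f) (aut_inv_fun f).
Proof. by move=> x; apply: (@aut_inj f); rewrite aut_inv_funK. Qed.

Fact aut_inv_funM (f : aut G) : {morph aut_inv_fun f : x y / x * y}.
Proof. by move=> x y; apply: (@aut_inj f); rewrite autM !aut_inv_funK. Qed.

Definition aut_one : aut G :=
  mkaut (fun x y : G => erefl (x * y)) (inv_bij (fun x : G => erefl x)).

Definition aut_inv (f : aut G) : aut G :=
  mkaut (@aut_inv_funM f) (Bijective (@aut_inv_funK f) (@aut_funK f)).

Fact aut_compM (f g : aut G) : {morph (aut_fun f \o aut_fun g) : x y / x * y}.
Proof. by move=> x y; rewrite /= !autM. Qed.

Definition aut_mul (f g : aut G) : aut G :=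
  mkaut (@aut_compM f g) (bij_comp (aut_bij f) (aut_bij g)).

Fact aut_mulA : associative aut_mul. Proof. by move=> f g h; exact: autP. Qed.
Fact aut_mul1g : left_id aut_one aut_mul. Proof. by move=> f; exact: autP. Qed.
Fact aut_mulg1 : right_id aut_one aut_mul. Proof. by move=> f; exact: autP. Qed.
Fact aut_mulVg : left_inverse aut_one aut_inv aut_mul.
Proof. by move=> f; apply: autP; exact: aut_funK. Qed.
Fact aut_mulgV : right_inverse aut_one aut_inv aut_mul.
Proof. by move=> f; apply: autP; exact: aut_inv_funK. Qed.

HB.instance Definition _ := isGroup.Build (aut G) aut_mulA aut_mul1g aut_mulg1
  aut_mulVg aut_mulgV.

Lemma aut_eval_near (f : aut G) (x : G) :
  nbhs f [set g : aut G | aut_fun g x = aut_fun f x].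
Proof.
have cx : continuous ((fun h : {ptws G -> discrete_topology G} => h x) \o
    (set_val : aut G -> _)).
  move=> h; apply: (@continuous_comp _ _ (discrete_topology G)).
    exact: initial_continuous.
  exact: (@proj_continuous _ (fun _ : G => discrete_topology G) x).
by apply: (cx f [set f x]); exact: discrete_set1.
Qed.

Lemma aut_cvgP (F : set_system (aut G)) (f : aut G) : Filter F ->
  F --> f <-> forall x, \forall g \near F, aut_fun g x = aut_fun f x.
Proof.
move=> FF; split=> [Ff x|Ff]; first exact: Ff (aut_eval_near f x).
suff Fv : (set_val : aut G -> {ptws G -> discrete_topology G}) @ F --> set_val f.
  move=> A [_ [[B oB <-] Bf sBA]]; apply: filterS sBA _; apply: Fv.
  exact: open_nbhs_nbhs.
apply/cvg_sup => x A [_ [[B oB <-] Bf sBA]].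
by apply: filterS (Ff x) => g gx; apply: sBA; rewrite /= -[set_val g x]/(g x) gx.
Qed.

Fact aut_mul_continuous : continuous (fun x : aut G * aut G => x.1 * x.2).
Proof.
move=> -[f g]; apply/aut_cvgP => x /=.
exists ([set f' | aut_fun f' (aut_fun g x) = aut_fun f (aut_fun g x)],
        [set g' | aut_fun g' x = aut_fun g x]).
  by split; exact: aut_eval_near.
move=> [f' g'] [/= f'E g'E].
by rewrite -[LHS]/(aut_fun f' (aut_fun g' x)) g'E f'E.
Qed.

Fact aut_inv_continuous : continuous (fun x : aut G => x^-1).
Proof.
move=> f; apply: (aut_cvgP _ (fmap_filter _ (nbhs_filter f))).2 => x /=.
apply: filterS (aut_eval_near f (aut_inv_fun f x)) => f' f'E.
change (aut_inv_fun f' x = aut_inv_fun f x).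
by apply: (@aut_inj f'); rewrite aut_inv_funK f'E aut_inv_funK.
Qed.

HB.instance Definition _ := isTopologicalGroup.Build (aut G)
  aut_mul_continuous aut_inv_continuous.

Fact inner_fun_morph (g : G) : {morph (fun x => g * x * g^-1) : x y / x * y}.
Proof. by move=> x y; rewrite !mulgA mulgVK. Qed.

Fact inner_fun_bij (g : G) : bijective (fun x => g * x * g^-1).
Proof.
exists (fun x => g^-1 * x * g) => x; first by rewrite !mulgA mulgVK mulVg mul1g.
by rewrite !mulgA mulgK mulgV mul1g.
Qed.

Definition inner (g : G) : aut G := mkaut (@inner_fun_morph g) (inner_fun_bij g).

Fact innerM : {morph inner : g h / g * h}.
Proof.
move=> g h; apply: autP => x.
by rewrite -[RHS]/(g * (h * x * h^-1) * g^-1) -[LHS]/(g * h * x * (g * h)^-1)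
  invgM !mulgA.
Qed.

HB.instance Definition _ := isMultiplicative.Build G (aut G) inner innerM.

Fact Inn_is_subgroup : is_subgroup (range inner).
Proof.
split; first by exists 1 => //; apply: autP => x; rewrite /= mul1g divg1.
move=> _ _ [g _ <-] [h _ <-]; exists (g / h) => //.
by apply: (@mulIg _ (inner h)); rewrite -gmulfM !mulgVK.
Qed.

Definition Inn : subgroup (aut G) := Subgroup Inn_is_subgroup.

Definition Linn : subgroup (aut G) := closure_group Inn.

Fact inner_in_Linn (g : G) : inner g \in subgroup_set Linn.
Proof. by apply/mem_set; apply: subset_closure; exists g. Qed.

Definition to_Linn (g : G) : Linn := exist _ (inner g) (inner_in_Linn g).

Fact to_LinnM : {morph to_Linn : g h / g * h}.
Proof. by move=> g h; apply: val_inj; exact: innerM. Qed.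

HB.instance Definition _ := isMultiplicative.Build G Linn to_Linn to_LinnM.

End Automorphisms.

Definition topologically_simple (G : topologicalGroupType) :=
  [set: G] <> [set 1] /\
  forall N : set G, is_normal_subgroup N -> closed N ->
    N = [set 1] \/ N = [set: G].

Definition compactly_generated (G : topologicalGroupType) :=
  exists2 K : set G, compact K & generated K = [set: G].

(* The q-adic integers as the inverse limit of the Z/q^n: an element is the
   sequence of its residues x n in [0, q^n[, which is a coherent sequence. *)
Definition prime_number := {q : nat | prime q}.

Definition padic_seqs (q : prime_number) :
    set (prod_topology (fun _ : nat => nat)) :=
  [set x | forall n, x n = x n.+1 %% val q ^ n].

Definition padic (q : prime_number) : Type := set_type (padic_seqs q).
HB.instance Definition _ (q : prime_number) :=
  Topological.copy (padic q) (set_type (padic_seqs q)).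

Section Padic.
Variable q : prime_number.
Local Notation p := (val q).

Definition residue (x : padic q) (n : nat) : nat := sval x n.

Let pX_gt0 n : 0 < p ^ n. Proof. by rewrite expn_gt0 prime_gt0 ?(valP q). Qed.

Lemma residueS (x : padic q) n : residue x n.+1 %% p ^ n = residue x n.
Proof. by case: x => x /= /set_mem xP; rewrite /residue /= [RHS]xP. Qed.

Lemma ltn_residue (x : padic q) n : residue x n < p ^ n.
Proof. by rewrite -residueS ltn_mod. Qed.

Lemma padicP (x y : padic q) : residue x =1 residue y -> x = y.
Proof. by move=> xy; apply: val_inj; apply/funext. Qed.

Definition mkpadic (x : nat -> nat) (xP : forall n, x n = x n.+1 %% p ^ n) :
  padic q := exist _ (x : prod_topology (fun _ : nat => nat)) (mem_set xP).

Let modXS m n : (m %% p ^ n.+1) %% p ^ n = m %% p ^ n.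
Proof. by rewrite modn_dvdm // expnS dvdn_mull. Qed.

Fact padic_zero_coherent n : 0 = 0 %% p ^ n.
Proof. by rewrite mod0n. Qed.

Fact padic_add_coherent (x y : padic q) n :
  (residue x n + residue y n) %% p ^ n =
  ((residue x n.+1 + residue y n.+1) %% p ^ n.+1) %% p ^ n.
Proof. by rewrite modXS -[RHS]modnDm !residueS. Qed.

Fact modn_opp_coherent (X k b : nat) : 0 < X -> b <= k * X ->
  (X - b %% X) %% X = (k * X - b) %% X.
Proof.
move=> X0 bY; apply/eqP; rewrite -(eqn_modDr b) [in eqbRHS]subnK //.
by rewrite -modnDmr subnK ?modnn ?modnMl // ltnW // ltn_mod.
Qed.

Fact padic_opp_coherent (x : padic q) n :
  (p ^ n - residue x n) %% p ^ n =
  ((p ^ n.+1 - residue x n.+1) %% p ^ n.+1) %% p ^ n.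
Proof.
rewrite modXS -residueS expnS; apply: modn_opp_coherent => //.
by rewrite -expnS ltnW // ltn_residue.
Qed.

Definition padic_zero : padic q := mkpadic padic_zero_coherent.
Definition padic_add (x y : padic q) : padic q :=
  mkpadic (padic_add_coherent x y).
Definition padic_opp (x : padic q) : padic q := mkpadic (padic_opp_coherent x).

Fact padic_addA : associative padic_add.
Proof.
by move=> x y z; apply: padicP => n; rewrite /residue /= modnDml modnDmr addnA.
Qed.
Fact padic_addC : commutative padic_add.
Proof. by move=> x y; apply: padicP => n; rewrite /residue /= addnC. Qed.
Fact padic_add0 : left_id padic_zero padic_add.
Proof.
by move=> x; apply: padicP => n; rewrite /residue /= add0n modn_small ?ltn_residue.
Qed.
Fact padic_addN : left_inverse padic_zero padic_opp padic_add.
Proof.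
move=> x; apply: padicP => n; rewrite /residue /= modnDml.
by rewrite subnK ?modnn // ltnW // ltn_residue.
Qed.

HB.instance Definition _ := GRing.isZmodule.Build (padic q)
  padic_addA padic_addC padic_add0 padic_addN.

End Padic.

(* The product, over all primes q dividing p, of d copies of Z_q. *)
Definition padic_product (p d : nat) :=
  prod_topology
    (fun i : {q : prime_number | val q %| p} * 'I_d => padic (val i.1)).

(* The subset A of G is isomorphic, as a topological group, to the product of
   the Z_q^d over the primes q dividing p. *)
Definition isomorphic_to_padic_product (G : topologicalGroupType) (A : set G)
    (p d : nat) :=
  exists (f : G -> padic_product p d) (g : padic_product p d -> G),
    [/\ forall x, A x -> g (f x) = x,
        forall z, A (g z) /\ f (g z) = z,
        forall x y i, A x -> A y -> f (x * y) i = (f x i + f y i)%R,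
        {within A, continuous f} &
        continuous g].

(* Main.v *)
Require Import Defs.
From HB Require Import structures.
From mathcomp Require Import all_boot all_order all_algebra.
From mathcomp Require Import all_classical topology tvs.

(** Number the chain from 0, writing H n for G (n+1).  The topology of Linn(T)
    is governed by the subgroups stab n, the pointwise stabilisers of the H n:
    each H n is finitely generated, so they are open, and they form a basis of
    neighbourhoods of 1 because the H n exhaust T.  Since T has trivial center,
    stab n is the centralizer of the image of H n.  An inner automorphism lies
    in stab n exactly when it is conjugation by an element of C_T(H n).  This
    centralizer is contained in C_T(H 0) = Z(H 0), hence in H n, so it is the
    center Z(H n).  As inner automorphisms are dense, stab n is the closure of
    the image of Z(H n) ([stab_to_Linn], [stab_closure]).  Everything follows
    from this description.

    Structure of stab 0.  Each element is, on H n, conjugation by some c in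
    Z(H 0), and c is unique modulo Z(H n), which corresponds to p^n Z^d in
    Z(H 0) = Z^d ([center_chain_divisible]).  So stab 0 is the inverse limit of
    the groups (Z/p^n)^d, that is, the product of the Z_q^d for q dividing p.
    [coordinates] is the relation between an automorphism and its q-adic
    coordinates; existence in one direction is a limit of inner automorphisms
    ([limit_conj]) combined with the Chinese remainder theorem.  An element
    of R whose image lies in the open subgroup stab 0 belongs to Z(H 0), hence
    is trivial; so the image of R is discrete.

    Normal subgroups.  A non-trivial normal subgroup contains a non-trivial
    commutator [a, inner x], which is again inner, hence meets the simple group
    Inn(T) and contains it; a closed one is everything.  Inn(T) itself is proper
    by a diagonal argument: a limit of inner automorphisms can be steered away
    from each of the countably many elements of T ([range_to_Linn_proper]).

    Exhaustion.  The abelian group stab n centralizes the image of H n, so the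
    product of the two is an open subgroup, called [level n], in which stab n is
    central; these subgroups increase and exhaust Linn(T).  A compact generating
    set would lie in one of them, forcing T = H n, although T is centerless and
    Z(H n) is not trivial.  A finitely generated subgroup A lies in one of them
    too; if A is centerless then it meets stab n trivially, so it is discrete,
    and it embeds in level n / stab n = H n / Z(H n).  That group is countable,
    so it has countably many finitely generated subgroups.

    Linear representations.  The centralizers Z(H n) of the H n in T strictly
    decrease, whereas a chain of commutants in a finite-dimensional matrix
    algebra stabilises ([no_commutant_chain]); so no linear representation of
    Linn(T) is faithful.  A continuous one has closed kernel, which is then the
    whole group by topological simplicity. *)

Set Implicit Arguments.
Unset Strict Implicit.
Unset Printing Implicit Defensive.

Import GRing.Theory.

Local Open Scope classical_set_scope.
Local Open Scope group_scope.

(** * Subgroups, homomorphisms and increasing chains *)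

Section Subgroups.
Variable G : groupType.
Implicit Types (A B S : set G) (x y : G).

Lemma is_subgroup1 A : is_subgroup A -> A 1.
Proof. by case. Qed.

Lemma is_subgroupV A x : is_subgroup A -> A x -> A x^-1.
Proof. by move=> [A1 AF] Ax; rewrite -[x^-1]div1g; exact: AF. Qed.

Lemma is_subgroupM A x y : is_subgroup A -> A x -> A y -> A (x * y).
Proof.
by move=> sA Ax Ay; rewrite -[y]invgK; apply: sA.2 => //; exact: is_subgroupV.
Qed.

Lemma center_is_subgroup A : is_subgroup A -> is_subgroup (center A).
Proof.
move=> sA; split=> [|x y [Ax xC] [Ay yC]].
  by split=> [|y _]; [exact: is_subgroup1 | exact/commute_sym/commute1].
split=> [|z Az]; first exact: sA.2.
apply: commute_sym; apply: commuteM; first exact/commute_sym/xC.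
by apply: commuteV; exact/commute_sym/yC.
Qed.

Lemma generated_is_subgroup S : is_subgroup (generated S).
Proof.
split; first by move=> A [[]].
by move=> x y Sx Sy A sA; apply: sA.1.2; [exact: Sx | exact: Sy].
Qed.

Lemma sub_generated S : S `<=` generated S.
Proof. exact: sub_smallest. Qed.

Lemma generated_sub S A : is_subgroup A -> S `<=` A -> generated S `<=` A.
Proof. by move=> sA SA x; apply. Qed.

(** Every element is the value of a word, and words over a finite alphabet of
    signed letters are countable. *)
Lemma countable_generated S : finite_set S -> countable (generated S).
Proof.
move=> /finite_seqP[s ->].
pose word (w : seq (bool * 'I_(size s))) : G :=
  \prod_(b <- w) if b.1 then tnth (in_tuple s) b.2 else (tnth (in_tuple s) b.2)^-1.
have wordV w : exists v, (word w)^-1 = word v.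
  elim: w => [|b w [v vE]].
    by exists [::]; rewrite /word !big_nil invg1.
  exists (rcons v (~~ b.1, b.2)).
  rewrite /word big_cons invgM -/(word w) vE /word -cats1 big_cat big_seq1 /=.
  by case: b.1 => //=; rewrite invgK.
apply: (@sub_countable _ _ _ (range word)); last first.
  by apply: sub_countable (countableP setT); exact: card_image_le.
apply: subset_card_le; apply: generated_sub.
  split; first by exists [::] => //; rewrite /word big_nil.
  move=> _ _ [v _ <-] [w _ <-]; have [w' ->] := wordV w.
  by exists (v ++ w') => //; rewrite /word big_cat.
move=> x /= /(tnthP (in_tuple s))[i ->]; exists [:: (true, i)] => //.
by rewrite /word big_seq1.
Qed.

End Subgroups.

Section Morphisms.
Variables (G K : groupType) (f : G -> K).
Hypothesis fM : {morph f : x y / x * y}.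

Lemma morphism1 : f 1 = 1.
Proof. by apply: (@mulgI _ (f 1)); rewrite -fM !mulg1. Qed.

Lemma morphismV : {morph f : x / x^-1}.
Proof. by move=> x; apply: (@mulgI _ (f x)); rewrite -fM !mulgV morphism1. Qed.

End Morphisms.

Section Chains.
Variables (X : choiceType) (H : nat -> set X).
Hypothesis H_succ : forall n, H n `<=` H n.+1.

Lemma chain_le m n : (m <= n)%N -> H m `<=` H n.
Proof.
elim: n => [|n IHn]; first by rewrite leqn0 => /eqP->.
by rewrite leq_eqVlt => /predU1P[->//|/IHn h] x /h/H_succ.
Qed.

Lemma finite_sub_chain S : finite_set S -> (forall x, S x -> exists n, H n x) ->
  exists n, S `<=` H n.
Proof.
move=> /finite_seqP[s ->{S}]; elim: s => [|x s IHs] sH; first by exists 0%N.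
have [|n nP] := IHs; first by move=> y ys; apply: sH; rewrite /= inE ys orbT.
have [m mP] := sH x (mem_head _ _).
exists (maxn m n) => y /=; rewrite inE => /predU1P[->|/nP].
  exact: chain_le (leq_maxl _ _) _ mP.
exact: chain_le (leq_maxr _ _) _.
Qed.

End Chains.

(** * The action of Linn(T) on T *)

Section LinnFun.
Variable T : groupType.
Implicit Types (a b c : Linn T) (x y g : T).

Definition Linn_fun a : T -> T := aut_fun (sval a).

Lemma Linn_eqP a b : Linn_fun a =1 Linn_fun b -> a = b.
Proof. by move=> ab; apply: val_inj; exact: autP. Qed.

Lemma Linn_fun_morph a : {morph Linn_fun a : x y / x * y}.
Proof. exact: autM. Qed.

Lemma Linn_fun_morphV a : {morph Linn_fun a : x / x^-1}.
Proof. exact: morphismV (Linn_fun_morph a). Qed.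

Lemma Linn_funM a b x : Linn_fun (a * b) x = Linn_fun a (Linn_fun b x).
Proof. by []. Qed.

Lemma Linn_funK a : cancel (Linn_fun a) (Linn_fun a^-1).
Proof. by move=> x; rewrite -Linn_funM mulVg. Qed.

Lemma Linn_funVK a : cancel (Linn_fun a^-1) (Linn_fun a).
Proof. by move=> x; rewrite -Linn_funM mulgV. Qed.

Lemma Linn_fun_to_Linn g x : Linn_fun (to_Linn g) x = g * x * g^-1.
Proof. by []. Qed.

Lemma conj_to_Linn a g : a * to_Linn g * a^-1 = to_Linn (Linn_fun a g).
Proof.
apply: Linn_eqP => x; rewrite !Linn_funM !Linn_fun_to_Linn !Linn_fun_morph.
by rewrite Linn_fun_morphV Linn_funVK.
Qed.

Lemma Linn_near_seq a (s : seq T) :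
  nbhs a [set b | forall x, x \in s -> Linn_fun b x = Linn_fun a x].
Proof.
elim: s => [|x s IHs]; first by apply: filterS filterT.
have ax : nbhs a [set b | Linn_fun b x = Linn_fun a x].
  exact: (@subgroup_val_continuous _ (Linn T) a _ (aut_eval_near (sval a) x)).
by apply: filterS2 ax IHs => b bx bs y; rewrite inE => /predU1P[->|/bs].
Qed.

(** Density of the inner automorphisms, in pointwise form. *)
Lemma Linn_approx_seq a (s : seq T) :
  exists g, forall x, x \in s -> Linn_fun a x = g * x * g^-1.
Proof.
have := set_mem (svalP a) [set f : aut T | forall x, x \in s -> f x = Linn_fun a x].
case; last by move=> _ [[g _ <-] gP]; exists g => x /gP <-.
elim: s => [|x s IHs]; first by apply: filterS filterT.
apply: filterS2 (aut_eval_near (sval a) x) IHs => b bx bs y.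
by rewrite inE => /predU1P[->|/bs].
Qed.

Lemma Linn_cvgP (F : set_system (Linn T)) a : Filter F ->
  F --> a <-> forall x, \forall b \near F, Linn_fun b x = Linn_fun a x.
Proof.
move=> FF; split=> [Fa x|Fa].
  apply: Fa; apply: filterS (Linn_near_seq a [:: x]) => b; apply.
  exact: mem_head.
suff Fv : (set_val : Linn T -> aut T) @ F --> sval a.
  move=> A [_ [[B oB <-] Bf sBA]]; apply: filterS sBA _; apply: Fv.
  exact: open_nbhs_nbhs.
by apply/aut_cvgP; exact: Fa.
Qed.

(** Closure is a pointwise condition: an automorphism that is inner on every
    finite set is a limit of inner automorphisms.  This is how elements of
    Linn(T) are constructed below. *)
Lemma Linn_of_locally_inner (f : T -> T) : {morph f : x y / x * y} -> bijective f ->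
  (forall s : seq T, exists g, forall x, x \in s -> f x = g * x * g^-1) ->
  exists a, Linn_fun a = f.
Proof.
move=> fM fB fa; pose u := mkaut fM fB.
suff Lu : u \in subgroup_set (Linn T) by exists (exist _ u Lu).
apply/mem_set => B uB; pose F : set_system (aut T) :=
  filter_from setT (fun s : seq T => [set v : aut T | forall x, x \in s -> v x = f x]).
have FF : Filter F.
  apply: filter_from_filter; first by exists [::].
  move=> s t _ _; exists (s ++ t) => // v vP.
  by split=> x xs; apply: vP; rewrite mem_cat xs ?orbT.
have /(_ _ uB)[s _ sB] : F --> u.
  by apply/aut_cvgP => x; exists [:: x] => // v; apply; exact: mem_head.
have [g gP] := fa s; exists (inner g); split; first by exists g.
by apply: sB => x /gP ->.
Qed.

End LinnFun.

(** * Generators, discrete subspaces and isomorphisms *)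

(** The equalizer of two homomorphisms is a subgroup. *)
Lemma generated_agree (G K : groupType) (f g : G -> K) (S : set G) :
  {morph f : x y / x * y} -> {morph g : x y / x * y} -> {in S, f =1 g} ->
  forall x, generated S x -> f x = g x.
Proof.
move=> fM gM fg x Sx; apply: (Sx [set y | f y = g y]); split=> [|y Sy].
  split=> [|y z /= yE zE]; first by rewrite /= (morphism1 fM) (morphism1 gM).
  by rewrite /= fM gM (morphismV fM) (morphismV gM) yE zE.
by apply: fg; exact/mem_set.
Qed.

Lemma conjugation_morph (G : groupType) (g : G) :
  {morph (fun x => g * x * g^-1) : x y / x * y}.
Proof. exact: inner_fun_morph. Qed.

Lemma conj_fixP (G : groupType) (g x : G) : g * x * g^-1 = x <-> commute g x.
Proof.
split=> [e|e]; first by rewrite /commute -[in RHS]e mulgVK.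
by rewrite e mulgK.
Qed.

Lemma discrete_subset (X : topologicalType) (A : set X) :
  (forall x, A x -> exists2 V, nbhs x V & V `&` A `<=` [set x]) ->
  discrete_space (set_type A).
Proof.
move=> Adisc B; rewrite openE => x Bx.
have [V Vx VA] := Adisc (sval x) (set_mem (svalP x)).
have : nbhs x (set_val @^-1` V) by exact: (@initial_continuous _ _ set_val).
apply: filterS => y Vy; suff -> : y = x by [].
by apply: val_inj; apply: VA; split=> //; exact: set_mem (svalP y).
Qed.

Lemma morph_bij_isomorphic (G K : groupType) (f : G -> K) :
  {morph f : x y / x * y} -> bijective f -> isomorphic G K.
Proof.
move=> fM fB; pose fG := isMultiplicative.Build G K f fM.
by exists (HB.pack_for {multiplicative G -> K} f fG).
Qed.

Lemma isomorphic_trans (G K L : groupType) :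
  isomorphic G K -> isomorphic K L -> isomorphic G L.
Proof.
move=> [f fB] [g gB]; apply: (@morph_bij_isomorphic G L (g \o f)); last exact: bij_comp.
by move=> x y; rewrite /= !gmulfM.
Qed.

(** * Commutants of matrices *)

(** The matrices a 0, a 1, ... are linearly independent: in a relation between
    them the term of least index i would be a combination of later ones, all of
    which commute with g i. *)
Lemma no_commutant_chain (F : fieldType) m (a g : nat -> 'M[F]_m) :
  (forall i, a i *m g i <> g i *m a i)%R ->
  (forall i j, (i < j)%N -> (a j *m g i = g i *m a j)%R) -> False.
Proof.
move=> anc ac; pose X k n := [seq a i | i <- iota k n].
have freeX n k : free (X k n).
  elim: n k => [|n IHn] k; first exact: nil_free.
  rewrite /X /= free_cons -/(X k.+1 n) IHn andbT; apply/negP => ak.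
  apply: (anc k); rewrite (coord_span (X := in_tuple (X k.+1 n)) ak).
  rewrite mulmx_suml mulmx_sumr; apply: eq_bigr => i _.
  rewrite -scalemxAl -scalemxAr; congr (_ *: _)%R.
  have i_n : (i < n)%N by move: (ltn_ord i); rewrite [X in (_ < X)%N]size_map size_iota.
  rewrite (nth_map 0%N) ?size_iota // nth_iota //; apply: ac.
  by rewrite addSn ltnS leq_addr.
have := freeX (m * m).+1 0%N; rewrite /free size_map size_iota => /eqP dX.
have := dimvS (subvf <<X 0%N (m * m).+1>>%VS).
by rewrite dX dimvf dim_matrix ltnn.
Qed.

(** The entries of a matrix depend continuously on it, and points of the
    Hausdorff field F are closed. *)
Lemma closed_preimage_unit_matrix (X : topologicalType) (F : topologicalFieldType) m
    (f : X -> 'M[F]_m) :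
  hausdorff_space F -> continuous f -> closed [set x | f x = 1%:M%R].
Proof.
move=> hF cf; rewrite -openC openE => x /= fx.
have [i [j ij]] : exists i j, f x i j <> (1%:M%R : 'M[F]_m) i j.
  apply: contrapT => h; apply: fx; apply/matrixP => i j.
  by apply: contrapT => ij; apply: h; exists i, j.
have cl : closed [set (1%:M%R : 'M[F]_m) i j].
  exact: (accessible_closed_set1 (hausdorff_accessible hF)).
have fxN : nbhs (f x) [set M : 'M[F]_m | M i j <> (1%:M%R : 'M[F]_m) i j].
  exists (fun k l => if (k == i) && (l == j)
      then ~` [set (1%:M%R : 'M[F]_m) i j] else setT).
    move=> k l; case: ifP => [/andP[/eqP -> /eqP ->]|_]; last exact: filterT.
    by apply: open_nbhs_nbhs; split => //; exact: closed_openC.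
  by move=> M /(_ i j); rewrite !eqxx.
move: (cf x _ fxN); rewrite nbhs_filterE /=.
by apply: filterS => y /= ne e; apply: ne; rewrite e.
Qed.

(** * Congruences modulo powers of primes *)

Lemma dvdz_sub_trans (d x y z : int) :
  (d %| x - y)%Z%R -> (d %| y - z)%Z%R -> (d %| x - z)%Z%R.
Proof. by move=> dxy dyz; rewrite -(subrKA y) rpredD. Qed.

Lemma dvdz_sub_sym (d x y : int) : (d %| x - y)%Z%R = (d %| y - x)%Z%R.
Proof. by rewrite -opprB rpredN. Qed.

Lemma dvdz_subn (d m n : nat) : (Posz d %| Posz m - Posz n)%Z%R = (m == n %[mod d]).
Proof. by rewrite -eqz_mod_dvd !modz_nat eqz_nat. Qed.

(** Stated for a list of primes so that it can be proved by induction from the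
    case of two coprime moduli. *)
Lemma crt_primes (s : seq nat) (r : nat -> nat) N : uniq s -> all prime s ->
  exists m, forall q, q \in s -> m = r q %[mod q ^ N].
Proof.
elim: s => [|q s IHs] /=; first by exists 0%N.
move=> /andP[qs us] /andP[pq ps]; have [m mP] := IHs us ps.
pose M := (\prod_(l <- s) l ^ N)%N.
have cop : coprime (q ^ N) M.
  rewrite /M big_seq.
  apply: (big_ind (fun M => is_true (coprime (q ^ N) M))) => [|a b qa qb|l ls].
  - exact: coprimen1.
  - by rewrite coprimeMr qa.
  apply: coprimeXl; apply: coprimeXr; have pl := allP ps _ ls.
  rewrite prime_coprime // dvdn_prime2 //.
  by apply: contraNneq qs => ->.
exists (chinese (q ^ N)%N M (r q) m); move=> l; rewrite inE => /predU1P[->|ls].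
  exact: chinese_modl.
rewrite -mP //; have lM : (l ^ N %| M)%N by rewrite /M (big_rem l) //= dvdn_mulr.
by rewrite -(modn_dvdm _ lM) chinese_modr // modn_dvdm.
Qed.

(** The q-part of p^n is q^(n e), where e is the exponent of q in p; since
    e < q^e <= p, divisibility by q^(n p) for each q suffices.  Using the one
    exponent n p for all q avoids mentioning the individual exponents. *)
Lemma dvdn_exp_primes (p n m : nat) : (0 < p)%N ->
  (forall q, prime q -> q %| p -> q ^ (n * p) %| m)%N -> (p ^ n %| m)%N.
Proof.
move=> p0 qm; apply/dvdn_partP; first by rewrite expn_gt0 p0.
move=> q; rewrite mem_primes => /and3P[pq _ qpn].
have qp : (q %| p)%N by rewrite Euclid_dvdX // in qpn; case/andP: qpn.
rewrite p_part lognX; apply: dvdn_trans (qm q pq qp); apply: dvdn_exp2l.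
rewrite leq_mul2l; apply/orP; right; apply: ltnW.
apply: leq_trans (dvdn_leq p0 (pfactor_dvdnn q p)).
exact: ltn_expl (prime_gt1 pq).
Qed.

(** * Topology of the q-adic integers and of their products *)

(** Compactness does not depend on the ambient space: a filter on the subspace
    and its image in the ambient space have the same cluster points in A. *)
Lemma set_type_compact (X : topologicalType) (A : set X) :
  compact A -> compact [set: set_type A].
Proof.
move=> cA F PF _.
have [|x [Ax xF]] := cA (set_val @ F) _.
  by rewrite /fmap /=; apply: filterS filterT => y _; exact: set_mem (svalP y).
exists (exist _ x (mem_set Ax)); split=> // B C FB [_ [[O oO <-] Ox OC]].
have FB' : (set_val @ F) (set_val @` B).
  have := FB; rewrite -[F B]/(nbhs F B) => {}FB.
  by apply: filterS FB => z Bz; exists z.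
have [y [[z Bz zy] Oy]] := xF _ _ FB' (open_nbhs_nbhs (conj oO Ox)).
by exists z; split=> //; apply: OC; rewrite /= zy.
Qed.

Section PadicTopology.
Variable q : prime_number.
Implicit Types x y : padic q.

Lemma residue_mod x m n : (m <= n)%N -> residue x n = residue x m %[mod val q ^ m].
Proof.
elim: n => [|n IHn]; first by rewrite leqn0 => /eqP->.
rewrite leq_eqVlt => /predU1P[->//|mn]; rewrite -(IHn mn) -(residueS x n).
by rewrite modn_dvdm // dvdn_exp2l.
Qed.

(** The coherent sequences form a closed subset of the product of the finite
    sets of residues modulo q^n. *)
Lemma padic_compact : compact [set: padic q].
Proof.
apply: set_type_compact.
pose K := [set f : prod_topology (fun _ : nat => nat) | forall n, `I_(val q ^ n) (f n)].
have cK : compact K.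
  by apply: (@tychonoff nat (fun=> nat) (fun n => `I_(val q ^ n))) => n;
    apply: finite_compact.
apply: subclosed_compact cK _; last first.
  move=> f fP n; rewrite /= (fP n) ltn_mod expn_gt0.
  by rewrite prime_gt0 // (valP q).
rewrite -openC openE => f /= /existsNP[n fn].
have cn k : nbhs f [set g : prod_topology (fun _ : nat => nat) | g k = f k].
  by apply: (@proj_continuous nat (fun=> nat) k f [set f k]); exact: discrete_set1.
apply: filterS2 (cn n) (cn n.+1) => g gn gn1 /(_ n).
by rewrite gn gn1.
Qed.

(** A sequence of integers that is Cauchy at the prescribed rate has a limit in
    Z_q. *)
Lemma padic_of_int (s : nat -> int) :
  (forall n, (Posz (val q ^ n)%N %| s n.+1 - s n)%Z)%R ->
  exists x, forall n, (Posz (val q ^ n)%N %| s n - Posz (residue x n))%Z%R.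
Proof.
move=> sP; have q0 n : (0 < val q ^ n)%N by rewrite expn_gt0 prime_gt0 // (valP q).
pose r n := absz (s n %% Posz (val q ^ n)%N)%Z.
have rE n : Posz (r n) = (s n %% Posz (val q ^ n)%N)%Z.
  by rewrite /r gez0_abs // modz_ge0 // eqz_nat -lt0n.
have rs n : (Posz (val q ^ n)%N %| s n - Posz (r n))%Z%R.
  by rewrite -eqz_mod_dvd rE modz_mod.
have r_lt n : (r n < val q ^ n)%N by rewrite -ltz_nat rE ltz_pmod // ltz_nat.
suff rP n : r n = r n.+1 %% val q ^ n by exists (mkpadic rP).
rewrite -[LHS](modn_small (r_lt n)); apply/eqP; rewrite -dvdz_subn.
have qn : (Posz (val q ^ n)%N %| Posz (val q ^ n.+1)%N)%Z.
  by rewrite dvdzE /= dvdn_exp2l.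
apply: (dvdz_sub_trans (y := s n)); first by rewrite dvdz_sub_sym.
apply: (dvdz_sub_trans (y := s n.+1)); first by rewrite dvdz_sub_sym.
exact: dvdz_trans qn (rs n.+1).
Qed.

Lemma padic_close_eq x y (s : nat -> int) :
  (forall n, (Posz (val q ^ n)%N %| s n - Posz (residue x n))%Z%R) ->
  (forall n, (Posz (val q ^ n)%N %| s n - Posz (residue y n))%Z%R) -> x = y.
Proof.
move=> sx sy; apply: padicP => n.
rewrite -[LHS](modn_small (ltn_residue x n)) -[RHS](modn_small (ltn_residue y n)).
apply/eqP; rewrite -dvdz_subn; apply: dvdz_sub_trans (sy n).
by rewrite dvdz_sub_sym.
Qed.

Lemma padic_cvgP (F : set_system (padic q)) x : Filter F ->
  (forall n, \forall y \near F, residue y n = residue x n) -> F --> x.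
Proof.
move=> FF Fx.
suff Fv : (set_val : padic q -> prod_topology (fun _ : nat => nat)) @ F --> set_val x.
  move=> A [_ [[B oB <-] Bx sBA]]; apply: filterS sBA _; apply: Fv.
  exact: open_nbhs_nbhs.
apply/cvg_sup => n A [_ [[B oB <-] Bx sBA]].
apply: filterS (Fx n) => y yx; apply: sBA.
by rewrite /= -[set_val y n]/(residue y n) yx.
Qed.

Lemma residue_near x n : nbhs x [set y | residue y n = residue x n].
Proof.
have cn : continuous ((fun f : prod_topology (fun _ : nat => nat) => f n) \o
    (set_val : padic q -> _)).
  move=> y; apply: (@continuous_comp _ _ nat).
    exact: initial_continuous.
  exact: (@proj_continuous _ (fun=> nat) n).
by apply: (cn x [set residue x n]); exact: discrete_set1.
Qed.

End PadicTopology.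

Section PadicProduct.
Variables p d : nat.
Local Notation index := ({q : prime_number | val q %| p} * 'I_d)%type.
Implicit Types z w : padic_product p d.

Lemma padic_product_compact : compact [set: padic_product p d].
Proof.
rewrite (_ : setT = [set f : padic_product p d |
  forall i, [set: padic (val i.1)] (f i)]); last by apply/seteqP.
apply: (@tychonoff index (fun i => padic (val i.1)) (fun i => setT)) => i.
exact: padic_compact.
Qed.

Lemma padic_product_cvgP (F : set_system (padic_product p d)) z : Filter F ->
  (forall i n, \forall w \near F, residue (w i) n = residue (z i) n) -> F --> z.
Proof.
move=> FF Fz; apply/cvg_sup => i A [_ [[B oB <-] Bz sBA]].
apply: filterS sBA _.
have : (fun w : padic_product p d => w i) @ F --> z i.
  by apply: padic_cvgP => n; exact: Fz.
by apply; exact: open_nbhs_nbhs.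
Qed.

(** Only finitely many residues are prescribed, because the primes q dividing p
    are at most p. *)
Lemma padic_product_near z n : (0 < p)%N ->
  nbhs z [set w | forall i, residue (w i) n = residue (z i) n].
Proof.
move=> p0.
have near1 (i : index) :
    nbhs z [set w : padic_product p d | residue (w i) n = residue (z i) n].
  exact: (@proj_continuous index (fun i => padic (val i.1)) i z _ (residue_near (z i) n)).
pose P (k : 'I_p.+1 * 'I_d) := [set w : padic_product p d | forall i : index,
  val (val i.1) = k.1 -> i.2 = k.2 -> residue (w i) n = residue (z i) n].
have : nbhs z [set w | forall k, P k w].
  apply: (@filter_forall _ _ P (nbhs z)) => -[k j].
  have [[i [ik ij]]|noi] := pselect (exists i : index, val (val i.1) = k /\ i.2 = j).
    apply: filterS (near1 i) => w wz i' ik' ij'; suff -> : i' = i by [].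
    case: i i' ik ij ik' ij' {wz} => [a b] [a' b'] /= ak -> ak' ->; congr pair.
    by do 2!apply: val_inj; exact: etrans ak' (esym ak).
  by apply: filterS filterT => w _ i ik ij; case: noi; exists i.
apply: filterS => w wP [q j].
have qp : (val (val q) < p.+1)%N by rewrite ltnS; apply: dvdn_leq p0 (valP q).
exact: (wP (Ordinal qp, j)).
Qed.

End PadicProduct.

(** * Pointwise stabilisers of a chain of finitely generated subgroups *)

Section ChainTopology.
Variables (T : groupType) (H : nat -> set T).
Hypothesis H_subgroup : forall n, is_subgroup (H n).
Hypothesis H_succ : forall n, H n `<=` H n.+1.
Hypothesis H_fg : forall n, finitely_generated (H n).
Hypothesis H_union : forall x, exists n, H n x.
Implicit Types (a b u : Linn T) (x y g c : T).

Lemma H_le m n x : (m <= n)%N -> H m x -> H n x.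
Proof. by move=> mn; exact: (chain_le H_succ). Qed.

Lemma H_generators n : exists s : seq T, generated [set` s] = H n.
Proof. by have [S /finite_seqP[s ->] SH] := H_fg n; exists s. Qed.

Lemma Linn_approx a n :
  exists g, forall x, H n x -> Linn_fun a x = g * x * g^-1.
Proof.
have [s <-] := H_generators n; have [g gP] := Linn_approx_seq a s.
exists g; apply: (generated_agree (Linn_fun_morph a) (conjugation_morph g)).
by move=> x /set_mem; exact: gP.
Qed.

(** An automorphism is determined on H n by its values on finitely many
    generators, so agreement on the whole of H n is an open condition. *)
Lemma Linn_near a n :
  nbhs a [set b | forall x, H n x -> Linn_fun b x = Linn_fun a x].
Proof.
have [s <-] := H_generators n; apply: filterS (Linn_near_seq a s) => b bs.
apply: (generated_agree (Linn_fun_morph b) (Linn_fun_morph a)).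
by move=> x /set_mem; exact: bs.
Qed.

Lemma Linn_nbhsP a (A : set (Linn T)) : nbhs a A <->
  exists n, [set b | forall x, H n x -> Linn_fun b x = Linn_fun a x] `<=` A.
Proof.
split=> [aA|[n nA]]; last exact: filterS nA (Linn_near a n).
pose F : set_system (Linn T) := filter_from setT
  (fun n => [set b | forall x, H n x -> Linn_fun b x = Linn_fun a x]).
have FF : Filter F.
  apply: filter_from_filter; first by exists 0%N.
  move=> m n _ _; exists (maxn m n) => // b bP.
  by split=> x xH; apply: bP; apply: H_le xH; rewrite leq_max leqnn ?orbT.
have /(_ _ aA)[n _ nA] : F --> a; last by exists n.
by apply/Linn_cvgP => x; have [n nx] := H_union x; exists n => // b; exact.
Qed.

Lemma Linn_of_chain_inner (f : T -> T) : {morph f : x y / x * y} -> bijective f ->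
  (forall n, exists g, forall x, H n x -> f x = g * x * g^-1) ->
  exists a, Linn_fun a = f.
Proof.
move=> fM fB fP; apply: Linn_of_locally_inner => // s.
have [|n sn] := @finite_sub_chain _ H H_succ [set` s] (finite_seq s).
  by move=> x _; exact: H_union.
by have [g gP] := fP n; exists g => x /sn/gP.
Qed.

Definition stab n : set (Linn T) := [set a | forall x, H n x -> Linn_fun a x = x].

Lemma stab_subgroup n : is_subgroup (stab n).
Proof.
split=> // a b aS bS x Hx; rewrite Linn_funM -[x in RHS]aS //; congr Linn_fun.
by rewrite -{1}[x]bS // Linn_funK.
Qed.

Lemma coset_stab n a b : stab n (a^-1 * b) <->
  (forall x, H n x -> Linn_fun b x = Linn_fun a x).
Proof.
split=> abP x Hx; first by rewrite -[x in RHS]abP // Linn_funM Linn_funVK.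
by rewrite Linn_funM abP // Linn_funK.
Qed.

Lemma stab_nbhsP a (A : set (Linn T)) : nbhs a A <->
  exists n, forall u, stab n u -> A (a * u).
Proof.
split=> [/Linn_nbhsP[n nA]|[n nA]].
  by exists n => u uS; apply: nA; apply/coset_stab; rewrite mulKg.
by apply/Linn_nbhsP; exists n => b /coset_stab/nA; rewrite mulVKg.
Qed.

(** A union of left cosets of an open subgroup is clopen. *)
Lemma coset_union_clopen n (A : set (Linn T)) :
  (forall a u, A a -> stab n u -> A (a * u)) -> open A /\ closed A.
Proof.
move=> Ast; split.
  by rewrite openE => a Aa; apply/stab_nbhsP; exists n => u /(Ast _ _ Aa).
rewrite -openC openE => a nAa; apply/stab_nbhsP; exists n => u Su Aau.
by apply: nAa; rewrite -[a](mulgK u); apply: Ast Aau (is_subgroupV (stab_subgroup n) Su).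
Qed.

Lemma stab_clopen n : open (stab n) /\ closed (stab n).
Proof.
apply: (@coset_union_clopen n) => a u Sa Su.
exact: is_subgroupM (stab_subgroup n) Sa Su.
Qed.

Lemma Linn_zero_dimensional : zero_dimensional (Linn T).
Proof.
move=> a b ab; have [x xab] : exists x, Linn_fun a x <> Linn_fun b x.
  by apply/existsNP => h; move/eqP: ab; apply; exact: Linn_eqP.
have [n nx] := H_union x; exists [set c | Linn_fun c x = Linn_fun a x].
split=> // [|bx]; last by apply: xab; rewrite -bx.
by apply: (@coset_union_clopen n) => c u /= <- Su; rewrite Linn_funM Su.
Qed.

Lemma range_to_Linn_dense : closure (range (@to_Linn T)) = setT.
Proof.
apply/seteqP; split=> // a _ A /Linn_nbhsP[n nA].
have [g gP] := Linn_approx a n.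
by exists (to_Linn g); split; [exists g|apply: nA => x /gP ->].
Qed.

(** * Stabilisers as closures of centers, and the exhaustion by levels *)

Section Centralizers.
Hypothesis T_centerless : centerless [set: T].
Hypothesis H_centralizer : forall n, centralizer setT (H n) = center (H n).

Lemma to_Linn_inj : injective (@to_Linn T).
Proof.
move=> g h gh; apply/divg1_eq.
suff : center [set: T] (g / h) by rewrite T_centerless.
split=> // x _; apply/conj_fixP.
have -> : g / h * x * (g / h)^-1 = Linn_fun (to_Linn g) (h^-1 * x * h).
  by rewrite Linn_fun_to_Linn invgM invgK !mulgA.
by rewrite gh Linn_fun_to_Linn !mulgA mulgV mul1g mulgK.
Qed.

Lemma stab_to_Linn n g : stab n (to_Linn g) <-> center (H n) g.
Proof.
rewrite -H_centralizer; split=> [gS|[_ gC] x Hx]; last exact/conj_fixP/gC.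
by split=> // x Hx; apply/conj_fixP; exact: gS.
Qed.

(** Conjugation by a sends inner g to inner (a g), and g is recovered from
    inner g; so a fixes g exactly when it commutes with inner g. *)
Lemma stab_centralizer n :
  stab n = centralizer setT (@to_Linn T @` H n).
Proof.
apply/seteqP; split=> a aP.
  split=> // _ [g Hg <-]; apply/conj_fixP.
  by rewrite conj_to_Linn aP.
move=> x Hx; apply: to_Linn_inj; rewrite -conj_to_Linn; apply/conj_fixP.
by apply: aP.2; exists x.
Qed.

(** The inner automorphism that approximates a may be taken in stab n itself,
    because stab n is open. *)
Lemma stab_approx n k a : stab n a ->
  exists2 c, center (H n) c & forall x, H k x -> Linn_fun a x = c * x * c^-1.
Proof.
move=> aS; have [c cP] := Linn_approx a (maxn n k).
exists c => [|x Hx]; last by apply: cP; exact: H_le (leq_maxr _ _) Hx.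
apply/stab_to_Linn => x Hx; rewrite Linn_fun_to_Linn -cP ?aS //.
exact: H_le (leq_maxl _ _) Hx.
Qed.

Lemma stab_closure n : closure (@to_Linn T @` center (H n)) = stab n.
Proof.
apply/seteqP; split=> a.
  have [_ /closure_id ->] := stab_clopen n; apply: closure_subset.
  by move=> _ [c Zc <-]; exact/stab_to_Linn.
move=> aS A /Linn_nbhsP[k kA]; have [c Zc cP] := stab_approx k aS.
by exists (to_Linn c); split; [exists c|apply: kA => x /cP].
Qed.

Lemma center_sub n c : center (H n) c -> H n c.
Proof. by case. Qed.

(** On a given point both automorphisms are conjugations by elements of the
    abelian group Z(H n). *)
Lemma stab_commute n a b : stab n a -> stab n b -> commute a b.
Proof.
move=> aS bS; apply: Linn_eqP => x.
have [k kx] := H_union x; have kx' := H_le (leq_maxr n k) kx.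
have [c Zc cP] := stab_approx (maxn n k) aS.
have [d Zd dP] := stab_approx (maxn n k) bS.
have Hn y : H n y -> H (maxn n k) y by exact: H_le (leq_maxl _ _).
have Hax : H (maxn n k) (Linn_fun a x).
  by rewrite cP //; apply: (H_subgroup _).2;
    [apply: is_subgroupM (H_subgroup _) _ _|]=> //; exact/Hn/center_sub.
rewrite !Linn_funM [Linn_fun b x]dP // (dP _ Hax) !Linn_fun_morph Linn_fun_morphV.
by rewrite (aS _ (center_sub Zd)).
Qed.

(** The open subgroup generated by the image of H n and stab n; it is their
    product because they commute. *)
Definition level n : set (Linn T) :=
  [set a | exists2 g, H n g & stab n ((to_Linn g)^-1 * a)].

Lemma level_decomp n a : level n a <->
  exists g u, [/\ H n g, stab n u & a = to_Linn g * u].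
Proof.
split=> [[g Hg gS]|[g [u [Hg uS ->]]]]; last by exists g; rewrite ?mulKg.
by exists g, ((to_Linn g)^-1 * a); split=> //; rewrite mulVKg.
Qed.

Lemma stab_commute_H n u g : stab n u -> H n g -> commute u (to_Linn g).
Proof. by rewrite stab_centralizer => -[_ uC] Hg; apply: uC; exists g. Qed.

Lemma stab_central n u a : stab n u -> level n a -> commute u a.
Proof.
move=> uS /level_decomp[g [v [Hg vS ->]]]; apply: commuteM.
  exact: stab_commute_H Hg.
exact: stab_commute vS.
Qed.

Lemma to_LinnV g : to_Linn g^-1 = (to_Linn g)^-1.
Proof. exact: (morphismV (@to_LinnM T)). Qed.

Lemma level_subgroup n : is_subgroup (level n).
Proof.
split.
  exists 1; first exact: is_subgroup1 (H_subgroup _).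
  by rewrite mulg1 -to_LinnV invg1 => x _; rewrite Linn_fun_to_Linn mul1g divg1.
move=> a b /level_decomp[g [u [Hg uS ->]]] /level_decomp[h [v [Hh vS ->]]].
apply/level_decomp; exists (g / h), (u / v); split.
- exact: (H_subgroup n).2.
- exact: (stab_subgroup n).2.
have -> : to_Linn (g / h) = to_Linn g / to_Linn h :> Linn T.
  by rewrite -to_LinnV -to_LinnM.
have uvh : commute (u / v) (to_Linn h)^-1.
  by rewrite -to_LinnV; apply: stab_commute_H;
    [exact: (stab_subgroup n).2 | exact: is_subgroupV (H_subgroup _) Hh].
by rewrite invgM -[RHS]mulgA -uvh !mulgA.
Qed.

Lemma stab_sub_level n : stab n `<=` level n.
Proof.
move=> u uS; apply/level_decomp; exists 1, u; split=> //.
  exact: is_subgroup1 (H_subgroup _).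
by rewrite (morphism1 (@to_LinnM T)) mul1g.
Qed.

Lemma to_Linn_level n g : H n g -> level n (to_Linn g).
Proof.
by move=> Hg; exists g => //; rewrite mulVg; exact: is_subgroup1 (stab_subgroup n).
Qed.

(** An element u of stab n is inner c modulo stab (n+1) for some c in Z(H n),
    and c is absorbed into H (n+1). *)
Lemma level_succ n : level n `<=` level n.+1.
Proof.
move=> a /level_decomp[g [u [Hg uS ->]]].
have [c Zc cP] := stab_approx n.+1 uS; exists (g * c).
  apply: H_succ; apply: is_subgroupM Hg _; first exact: H_subgroup.
  exact: center_sub.
rewrite (to_LinnM g c) invgM mulgA mulgVK.
by apply/coset_stab => x /cP.
Qed.

(** Inn(T) stab 0 is the whole group by density, stab 0 is contained in every
    level, and each element of T occurs in some H n. *)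
Lemma level_cover a : exists n, level n a.
Proof.
have [g gP] := Linn_approx a 0; have [n Hg] := H_union g; exists n.
have le0 : level 0 `<=` level n by exact: chain_le level_succ _ _ _.
rewrite -[a](mulVKg (to_Linn g)); apply: is_subgroupM (level_subgroup n) _ _.
  exact: to_Linn_level.
by apply/le0/stab_sub_level/coset_stab => x /gP.
Qed.

Lemma level_open n : open (level n).
Proof.
apply: (@coset_union_clopen n _ _).1 => a u La uS.
by apply: is_subgroupM (level_subgroup n) La _; exact: stab_sub_level.
Qed.

(** * Normal subgroups and countability *)

Hypothesis T_simple : simple_group T.

(** For a in N and a x <> x the commutator of a and inner x is inner by
    a x x^-1, so the preimage of N in T is a non-trivial normal subgroup. *)
Lemma normal_contains_inner (N : set (Linn T)) :
  is_normal_subgroup N -> N <> [set 1] -> range (@to_Linn T) `<=` N.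
Proof.
move=> [sN NJ] N1.
have [a Na a1] : exists2 a, N a & a <> 1.
  apply: contrapT => h; apply: N1; apply/seteqP; split=> [a Na|_ ->].
    by apply: contrapT => a1; apply: h; exists a.
  exact: is_subgroup1.
have [x xax] : exists x, Linn_fun a x <> x.
  by apply/existsNP => h; apply: a1; apply: Linn_eqP.
pose P := [set g | N (to_Linn g)].
have nP : is_normal_subgroup P.
  split=> [|g h Pg]; last by rewrite /P /conjg /= !to_LinnM to_LinnV; exact: NJ.
  split=> [|g h Pg Ph].
    by rewrite /P /= (morphism1 (@to_LinnM T)); exact: is_subgroup1.
  by rewrite /P /= to_LinnM to_LinnV; exact: sN.2.
have Px : P (Linn_fun a x * x^-1).
  rewrite /P /= to_LinnM -conj_to_Linn to_LinnV -!mulgA; apply: is_subgroupM => //.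
  have := NJ _ (to_Linn x)^-1 (is_subgroupV sN Na).
  by rewrite /conjg invgK.
have [P1|PT] := T_simple.2 P nP; last by move=> _ [g _ <-]; rewrite -[N _]/(P g) PT.
by move: Px; rewrite P1 => /divg1_eq.
Qed.

Lemma Linn_topologically_simple : topologically_simple (Linn T).
Proof.
split=> [L1|N nN cN].
  apply: T_simple.1; apply/seteqP; split=> // g _.
  apply: to_Linn_inj; rewrite (morphism1 (@to_LinnM T)).
  by have : [set: Linn T] (to_Linn g) by []; rewrite L1.
have [->|N1] := pselect (N = [set 1]); [by left|right].
apply/seteqP; split=> // a _; rewrite ((closure_id N).1 cN).
have : closure (range (@to_Linn T)) a by rewrite range_to_Linn_dense.
by apply: closure_subset; exact: normal_contains_inner.
Qed.

Lemma chain_union_countable : countable [set: T].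
Proof.
rewrite (_ : setT = \bigcup_(n in setT) H n); last first.
  by apply/seteqP; split=> // x _; have [n nx] := H_union x; exists n.
apply: bigcup_countable => // n _; have [s <-] := H_generators n.
exact: countable_generated.
Qed.

(** The cosets of stab n by inner automorphisms form a basis, by density. *)
Lemma Linn_second_countable : @second_countable (Linn T).
Proof.
pose B (k : T * nat) := [set a | stab k.2 ((to_Linn k.1)^-1 * a)].
exists (range B).
  apply: (@sub_countable _ _ _ [set: T * nat]); first exact: card_image_le.
  rewrite (_ : setT = setT `*` setT); last by apply/seteqP.
  by apply: countableX; [exact: chain_union_countable | exact: countableP].
split=> [_ [[g n] _ <-]|a A /stab_nbhsP[n nA]].
  apply: (@coset_union_clopen n _ _).1 => a u; rewrite /B /= mulgA.
  exact: is_subgroupM (stab_subgroup n).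
have [g gP] := Linn_approx a n.
have ga : stab n ((to_Linn g)^-1 * a) by apply/coset_stab => x /gP.
exists (B (g, n)); first by split => //; exists (g, n).
move=> b gb; rewrite -[b](mulVKg a); apply: nA.
rewrite -[b](mulVKg (to_Linn g)) mulgA; apply: is_subgroupM (stab_subgroup n) _ gb.
by rewrite -[to_Linn g]invgK -invgM; apply: is_subgroupV (stab_subgroup n) ga.
Qed.

(** The open subgroup stab 0 meets the image of R trivially, since an inner
    automorphism fixing H 0 is conjugation by an element of Z(H 0). *)
Lemma to_Linn_discrete (R : set T) : is_subgroup R ->
  R `&` center (H 0) = [set 1] -> discrete_space (set_type (@to_Linn T @` R)).
Proof.
move=> sR RZ; apply: discrete_subset => _ [g Rg <-].
exists [set b | stab 0 ((to_Linn g)^-1 * b)].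
  by apply/stab_nbhsP; exists 0%N => u; rewrite /= mulKg.
move=> b [bV [h Rh hb]]; move: bV.
rewrite -hb /= -to_LinnV -to_LinnM => /stab_to_Linn ghZ.
have : (R `&` center (H 0)) (g^-1 * h).
  by split=> //; apply: is_subgroupM sR (is_subgroupV sR Rg) Rh.
by rewrite RZ => gh; rewrite -[h](mulVKg g) gh mulg1.
Qed.

(** * Compact generation and linear representations *)

Hypothesis center_strict : forall n, exists2 c,
  center (H n) c & ~ center (H n.+1) c.

Lemma center_le m n : (m <= n)%N -> center (H n) `<=` center (H m).
Proof.
move=> mn c; rewrite -!H_centralizer => -[_ cC]; split=> // x Hx.
by apply: cC; exact: H_le Hx.
Qed.

Lemma H_proper n : H n <> setT.
Proof.
move=> HT; have [c] := center_strict n; rewrite HT T_centerless => -> [].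
split=> [|x _]; last exact/commute_sym/commute1.
exact: is_subgroup1 (H_subgroup _).
Qed.

(** Compactness turns the increasing open cover by the levels into one level;
    the inner automorphisms in level n come from H n, so T would be H n. *)
Lemma Linn_not_compactly_generated : ~ compactly_generated (Linn T).
Proof.
move=> [K cK KL].
have [n Kn] : exists n, K `<=` level n.
  have /compact_near_coveringP/(_ nat \oo (fun n a => level n a)) := cK.
  case=> [a _|n _ nK]; last by exists n; apply: nK => /=.
  have [n an] := level_cover a.
  exists (level n, [set m | (n <= m)%N]) => /=.
    by split; [apply: open_nbhs_nbhs; split=> //; exact: level_open | exists n].
  by move=> [b m] /= [bn nm]; exact: chain_le level_succ _ _ nm _ bn.
apply: (@H_proper n); apply/seteqP; split=> // g _.
have : level n (to_Linn g).
  have : generated K (to_Linn g) by rewrite KL.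
  by apply: generated_sub => //; exact: level_subgroup.
case=> h Hh; rewrite -to_LinnV -to_LinnM => /stab_to_Linn/center_sub hg.
by rewrite -[g](mulVKg h); exact: is_subgroupM.
Qed.

(** Choose c n in Z(H n) outside Z(H (n+1)) and g n in H (n+1) that does not
    commute with c n.  For j > n the element c j does commute with g n, so a
    faithful representation would contradict [no_commutant_chain]. *)
Lemma Linn_linear_trivial m (F : topologicalFieldType) (f : Linn T -> 'M[F]_m) :
  hausdorff_space F -> (forall a, f a \in unitmx) ->
  (forall a b, f (a * b) = (f a *m f b)%R) -> continuous f ->
  forall a, f a = 1%:M%R.
Proof.
move=> hF fU fM cf; pose N := [set x | f x = 1%:M%R].
have f1 : f 1 = 1%:M%R.
  have /(congr1 (mulmx (invmx (f 1)))) := fM 1 1.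
  by rewrite mulg1 mulKmx // mulVmx // => ->.
have fV a : f a = 1%:M%R -> f a^-1 = 1%:M%R.
  by move=> fa; have := fM a a^-1; rewrite mulgV fa mul1mx f1.
have nN : is_normal_subgroup N.
  split=> [|x y xN].
    by split=> // x y xN yN; rewrite /N /= fM xN (fV _ yN) mulmx1.
  by rewrite /N /conjg /= !fM xN mul1mx -fM mulVg.
have [_] := Linn_topologically_simple.
case/(_ N nN (closed_preimage_unit_matrix hF cf)) => [N1|NT a]; last first.
  by have : setT a by []; rewrite -NT.
have f_inj a b : f a = f b -> a = b.
  move=> ab; apply/divg1_eq; suff : N (a / b) by rewrite N1.
  by rewrite /N /= fM ab -fM mulgV.
have /choice[c cP] : forall n, exists c, center (H n) c /\ ~ center (H n.+1) c.
  by move=> n; have [c] := center_strict n; exists c.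
have /choice[g gP] : forall n, exists g, H n.+1 g /\ ~ commute (c n) g.
  move=> n; apply: contrapT => h; apply: (cP n).2.
  rewrite -H_centralizer; split=> // g Hg.
  by apply: contrapT => ncg; apply: h; exists g.
pose fT := f \o @to_Linn T; exfalso.
apply: (@no_commutant_chain F m (fT \o c) (fT \o g)).
  move=> i; rewrite /fT /= -!fM -!to_LinnM => /f_inj/to_Linn_inj.
  exact: (gP i).2.
move=> i j ij; rewrite /fT /= -!fM -!to_LinnM; congr (f (to_Linn _)).
exact: (center_le ij (cP j).1).2 (gP i).1.
Qed.

(** * Finitely generated centerless subgroups *)

Lemma fg_in_level (A : set (Linn T)) : finitely_generated A ->
  exists n, A `<=` level n.
Proof.
move=> [S fS <-]; have [|n Sn] := finite_sub_chain level_succ fS.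
  by move=> a _; exact: level_cover.
by exists n; apply: generated_sub => //; exact: level_subgroup.
Qed.

(** Elements of stab n commute with the whole of level n. *)
Lemma centerless_stab n (A : set (Linn T)) : centerless A -> A `<=` level n ->
  A `&` stab n `<=` [set 1].
Proof.
move=> <- An u [Au uS]; split=> // a /An; exact: stab_central.
Qed.

(** The open subgroup stab n meets A trivially. *)
Lemma fg_centerless_discrete (A : subgroup (Linn T)) :
  finitely_generated A -> centerless A -> discrete_space A.
Proof.
move=> fgA clA; have [n An] := fg_in_level fgA.
have sA := subgroupP A.
apply: discrete_subset => a Aa; exists [set b | stab n (a^-1 * b)].
  by apply/stab_nbhsP; exists n => u; rewrite /= mulKg.
move=> b [/= abS Ab]; rewrite -[b](mulVKg a).
suff -> : a^-1 * b = 1 by rewrite mulg1.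
by apply: (centerless_stab clA An); split=> //;
  apply: is_subgroupM sA (is_subgroupV sA Aa) Ab.
Qed.

(** The product set A stab n: it records exactly the image of A in the coset
    space Linn(T) / stab n. *)
Definition mod_stab n : set (Linn T) -> set (Linn T) :=
  fun A => [set b | exists2 a, A a & stab n (a^-1 * b)].

(** Since stab n is central in level n, the product set A stab n is closed under
    quotients. *)
Lemma mod_stab_subgroup n (A : set (Linn T)) :
  is_subgroup A -> A `<=` level n -> is_subgroup (mod_stab n A).
Proof.
move=> sA An; split=> [|b b' [a Aa ab] [a' Aa' ab']].
  exists 1; first exact: is_subgroup1.
  by rewrite mulg1 invg1; exact: is_subgroup1 (stab_subgroup n).
exists (a / a'); first exact: sA.2.
have [u uS bE] : exists2 u, stab n u & b = a * u.
  by exists (a^-1 * b); rewrite ?mulVKg.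
have [u' uS' bE'] : exists2 u, stab n u & b' = a' * u.
  by exists (a'^-1 * b'); rewrite ?mulVKg.
have -> : (a / a')^-1 * (b / b') = a' * ((u / u') / a').
  by rewrite bE bE' !invgM invgK !mulgA mulgVK.
have uuS : stab n (u / u') by exact: (stab_subgroup n).2.
rewrite (stab_central uuS) ?mulVKg //.
exact: is_subgroupV (level_subgroup n) (An _ Aa').
Qed.

(** Both A and B meet stab n trivially, so each maps isomorphically onto the
    same image in level n / stab n. *)
Lemma isomorphic_mod_stab n (A B : subgroup (Linn T)) :
  centerless A -> centerless B -> A `<=` level n -> B `<=` level n ->
  mod_stab n A = mod_stab n B -> isomorphic A B.
Proof.
move=> clA clB An Bn AB.
have lift (C D : subgroup (Linn T)) : mod_stab n C = mod_stab n D ->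
    forall x : C, exists y : D, stab n ((sval y)^-1 * sval x).
  move=> CD x; have : mod_stab n C (sval x).
    exists (sval x); first exact: set_mem (svalP x).
    by rewrite mulVg; exact: is_subgroup1 (stab_subgroup n).
  by rewrite CD => -[y Dy yx]; exists (exist _ y (mem_set Dy)).
have uniq (C : subgroup (Linn T)) : centerless C -> C `<=` level n ->
    forall (y z : C) a, stab n ((sval y)^-1 * a) -> stab n ((sval z)^-1 * a) ->
    y = z.
  move=> clC Cn y z a ya za; apply: val_inj; apply: (mulgI (sval z)^-1).
  rewrite mulVg; apply: (centerless_stab clC Cn); split.
    have Cz := is_subgroupV (subgroupP C) (set_mem (svalP z)).
    exact: is_subgroupM (subgroupP C) Cz (set_mem (svalP y)).
  have -> : (sval z)^-1 * \val y = ((sval z)^-1 * a) / ((sval y)^-1 * a).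
    by rewrite invgM invgK !mulgA mulgK.
  exact: (stab_subgroup n).2.
have /choice[f fP] := lift A B AB.
have /choice[g gP] := lift B A (esym AB).
have stabV (a b : Linn T) : stab n (a^-1 * b) -> stab n (b^-1 * a).
  by move=> /(is_subgroupV (stab_subgroup n)); rewrite invgM invgK.
apply: (@morph_bij_isomorphic A B f); last first.
  exists g => x.
    exact: (uniq A clA An _ _ _ (gP _) (stabV _ _ (fP _))).
  exact: (uniq B clB Bn _ _ _ (fP _) (stabV _ _ (gP _))).
move=> x y; apply: (uniq B clB Bn _ _ _ (fP _)).
have -> : (sval (f x * f y))^-1 * sval (x * y) =
    (sval (f y))^-1 * (((sval (f x))^-1 * sval x) * sval y).
  by rewrite invgM !mulgA.
rewrite [X in _ * X](stab_central (fP x)); last exact/An/set_mem/(svalP y).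
by rewrite mulgA; apply: is_subgroupM (stab_subgroup n) (fP y) (fP x).
Qed.

(** Modulo stab n each generator of A is the image of an element of H n; this
    finite list of elements of T is the countable invariant of A. *)
Lemma fg_mod_stab (A : set (Linn T)) n : finitely_generated A -> A `<=` level n ->
  exists s : seq T, (forall g, g \in s -> H n g) /\
    mod_stab n A = mod_stab n (generated (@to_Linn T @` [set` s])).
Proof.
move=> [S /finite_seqP[t ->] <-] An.
have [s sH] : exists s : seq T, [/\ forall g, g \in s -> H n g,
    forall a, a \in t -> exists2 g, g \in s & stab n ((to_Linn g)^-1 * a) &
    forall g, g \in s -> exists2 a, a \in t & stab n ((to_Linn g)^-1 * a)].
  have {An} : [set` t] `<=` level n by move=> a /sub_generated; exact: An.
  elim: t => [|a t IHt] tn; first by exists [::].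
  have [|s [sH ts st]] := IHt.
    by move=> b bt; apply: tn; rewrite /= inE bt orbT.
  have [g Hg ga] := tn a (mem_head _ _); exists (g :: s); split.
  - by move=> h /=; rewrite inE => /predU1P[->|/sH].
  - move=> b; rewrite inE => /predU1P[->|/ts[h hs hb]].
      by exists g; rewrite ?mem_head.
    by exists h; rewrite // inE hs orbT.
  - move=> h; rewrite inE => /predU1P[->|/st[b bt hb]].
      by exists a; rewrite ?mem_head.
    by exists b; rewrite // inE bt orbT.
exists s; case: sH => sH ts st; split=> //.
have stabV (a b : Linn T) : stab n (a^-1 * b) -> stab n (b^-1 * a).
  by move=> /(is_subgroupV (stab_subgroup n)); rewrite invgM invgK.
have sub (B C : set (Linn T)) : is_subgroup C -> C `<=` level n ->
    (forall b, B b -> mod_stab n C b) -> mod_stab n (generated B) `<=` mod_stab n C.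
  move=> sC Cn BC a [b Bb ba].
  have [|c Cc cb] := generated_sub (mod_stab_subgroup sC Cn) _ Bb; first exact: BC.
  exists c => //.
  have -> : c^-1 * a = (c^-1 * b) * (b^-1 * a) by rewrite !mulgA mulgK.
  exact: is_subgroupM (stab_subgroup n) cb ba.
have sgn : generated (@to_Linn T @` [set` s]) `<=` level n.
  apply: generated_sub; first exact: level_subgroup.
  by move=> _ [g gs <-]; apply/to_Linn_level/sH.
apply/seteqP; split; apply: sub => //; try exact: generated_is_subgroup.
  move=> a /ts[g gs ga]; exists (to_Linn g) => //.
  by apply: sub_generated; exists g.
move=> _ [g /st[a at_ ga] <-]; exists a; last exact: stabV.
exact: sub_generated.
Qed.

(** A class is determined by a level n together with a finite list of elements of
    the countable group T, namely generators of a representative modulo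
    stab n. *)
Lemma countable_fg_centerless_classes :
  countable [set C : set (subgroup (Linn T)) |
    exists A : subgroup (Linn T), [/\ finitely_generated A, centerless A &
      C = [set B : subgroup (Linn T) | [/\ finitely_generated B,
             centerless B & isomorphic A B]]]].
Proof.
have /countable_injP[e e_inj] := chain_union_countable.
pose class (A : subgroup (Linn T)) := [set B : subgroup (Linn T) |
  [/\ finitely_generated B, centerless B & isomorphic A B]].
pose good (k : nat * seq T) (A : subgroup (Linn T)) :=
  [/\ finitely_generated A, centerless A, A `<=` level k.1 &
    mod_stab k.1 A = mod_stab k.1 (generated (@to_Linn T @` [set` k.2]))].
pose Phi k : set (subgroup (Linn T)) :=
  [set B | exists2 A, good k A & class A B].
have PhiE k A : good k A -> Phi k = class A.
  move=> [fA cA An Ak]; apply/seteqP; split=> [B|B AB]; last by exists A.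
  move=> [A' [fA' cA' An' Ak'] [fB cB A'B]]; split=> //.
  apply: isomorphic_trans A'B; apply: isomorphic_mod_stab An An' _ => //.
  by rewrite Ak Ak'.
apply: (@sub_countable _ _ _ (range Phi)).
  apply: subset_card_le => C [A [fA cA ->]].
  have [n An] := fg_in_level fA; have [s [_ sA]] := fg_mod_stab fA An.
  by exists (n, s) => //; apply: PhiE.
apply: (@sub_countable _ _ _ [set: nat * seq T]); first exact: card_image_le.
apply/countable_injP; exists (fun k => choice.pickle (k.1, map e k.2)).
move=> [m s] [n t] _ _ /(pcan_inj choice.pickleK)[-> st]; congr pair.
by apply: inj_map st => x y; apply: e_inj; exact: mem_set.
Qed.

(** * Limits of inner automorphisms *)

(** Consecutive terms differ by an element that centralizes H n, so the
    conjugations by the c n stabilise on each element of T. *)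
Lemma conj_stable (c : nat -> T) m k x :
  (forall n, center (H n) ((c n)^-1 * c n.+1)) -> (m <= k)%N -> H m x ->
  c k * x * (c k)^-1 = c m * x * (c m)^-1.
Proof.
move=> cc + Hx; elim: k => [|k IHk]; first by rewrite leqn0 => /eqP->.
rewrite leq_eqVlt ltnS => /predU1P[->//|mk]; rewrite -IHk //.
have [z [_ zC] ->] : exists2 z, center (H k) z & c k.+1 = c k * z.
  by exists ((c k)^-1 * c k.+1); rewrite ?mulVKg.
by rewrite -[c k * z * x]mulgA (zC x (H_le mk Hx)) invgM !mulgA mulgK.
Qed.

(** Conjugation by c n on H n, for all n, glues to an automorphism.  Its inverse
    is glued in the same way from the inverses of the c n; this uses that c n
    lies in H 0, so that conjugation by c n preserves each H n. *)
Lemma limit_conj (c : nat -> T) : (forall n, H 0 (c n)) ->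
  (forall n, center (H n) ((c n)^-1 * c n.+1)) ->
  exists a, forall n x, H n x -> Linn_fun a x = c n * x * (c n)^-1.
Proof.
move=> cH cc; have /choice[N NP] := H_union.
pose F (b : nat -> T) x := b (N x) * x * (b (N x))^-1.
have FE (b : nat -> T) n x : (forall n, center (H n) ((b n)^-1 * b n.+1)) -> H n x ->
    F b x = b n * x * (b n)^-1.
  move=> bc Hx; rewrite /F -(conj_stable bc (leq_maxl (N x) n)) //.
  by rewrite (conj_stable bc (leq_maxr (N x) n)).
(* The inverse sequence satisfies the same hypothesis because c n commutes
   with the elements of Z(H n). *)
pose c' n := (c n)^-1.
have cc' n : center (H n) ((c' n)^-1 * c' n.+1).
  rewrite /c' invgK; have := is_subgroupV (center_is_subgroup (H_subgroup n)) (cc n).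
  rewrite invgM invgK => zC; suff -> : c n / c n.+1 = (c n.+1)^-1 * c n by [].
  have /zC.2 e : H n (c n)^-1.
    by apply: is_subgroupV (H_subgroup n) _; exact: H_le (cH n).
  by move: e; rewrite /commute mulgK => e; rewrite {1}e mulVKg.
have FK (b b' : nat -> T) : (forall n, center (H n) ((b n)^-1 * b n.+1)) ->
    (forall n, center (H n) ((b' n)^-1 * b' n.+1)) -> (forall n, H 0 (b n)) ->
    (forall n, b' n * b n = 1) -> cancel (F b) (F b').
  move=> bc bc' bH bb' x; have [n Hx] := H_union x.
  have Hb : H n (b n) by exact: H_le (bH n).
  rewrite (FE b n) // (FE b' n) //; last first.
    by apply: (H_subgroup n).2; first exact: is_subgroupM.
  by rewrite !mulgA bb' mul1g -mulgA -invgM bb' invg1 mulg1.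
have [|||a aE] := @Linn_of_chain_inner (F c).
- move=> x y; have [n Hx] := H_union x; have [m Hy] := H_union y.
  have Hx' := H_le (leq_maxl n m) Hx; have Hy' := H_le (leq_maxr n m) Hy.
  rewrite !(FE c (maxn n m)) //; last exact: is_subgroupM.
  exact: conjugation_morph.
- exists (F c'); apply: FK => // n; rewrite /c' ?mulVg ?mulgV //.
  exact: is_subgroupV.
- by move=> n; exists (c n) => x Hx; exact: FE.
by exists a => n x Hx; rewrite aE; exact: FE.
Qed.

(** Diagonal argument: enumerate T as g 0, g 1, ... and let the n-th step of a
    sequence c as in [limit_conj] decide whether to multiply by an element of
    Z(H n) outside Z(H (n+1)), so that c (n+1) differs from g n modulo
    Z(H (n+1)).  The limit is then different from every inner (g n). *)
Lemma range_to_Linn_proper : exists a, ~ range (@to_Linn T) a.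
Proof.
have /countable_injP[e e_inj] := chain_union_countable.
pose g n := xget 1 [set x | e x = n].
have gP x : g (e x) = x.
  apply: e_inj; rewrite ?inE //.
  by apply: (@xgetPex _ 1 [set y | e y = e x]); exists x.
have /choice[z zP] : forall n, exists c, center (H n) c /\ ~ center (H n.+1) c.
  by move=> n; have [c] := center_strict n; exists c.
pose c := fix c n := if n is k.+1 then
  if `[< center (H k.+1) ((g k)^-1 * c k) >] then c k * z k else c k else 1.
have cH n : H 0 (c n).
  elim: n => [|n IHn] /=; first exact: is_subgroup1 (H_subgroup 0).
  case: ifP => // _; apply: is_subgroupM (H_subgroup 0) IHn _.
  exact: center_sub (center_le (leq0n n) (zP n).1).
have cc n : center (H n) ((c n)^-1 * c n.+1).
  rewrite /=; case: ifP => _; first by rewrite mulKg; exact: (zP n).1.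
  by rewrite mulVg; exact: is_subgroup1 (center_is_subgroup (H_subgroup n)).
have cg n : ~ center (H n.+1) ((g n)^-1 * c n.+1).
  rewrite /=; case: asboolP => // gc; rewrite mulgA => gcz; apply: (zP n).2.
  rewrite -[z n](mulKg ((g n)^-1 * c n)).
  have sZ := center_is_subgroup (H_subgroup n.+1).
  by apply: is_subgroupM sZ (is_subgroupV sZ gc) gcz.
have [a aP] := limit_conj cH cc; exists a => -[x _ xa].
apply: (cg (e x)); rewrite gP; apply/stab_to_Linn; rewrite to_LinnM to_LinnV.
by apply/coset_stab => y Hy; rewrite xa (aP _ _ Hy).
Qed.

(** Inn(T) is normal by [conj_to_Linn] and proper by
    [range_to_Linn_proper]. *)
Lemma Linn_not_simple : ~ simple_group (Linn T).
Proof.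
move=> [_ /(_ (range (@to_Linn T)))]; case.
- split=> [|_ a [g _ <-]].
    split; first by exists 1; rewrite ?(morphism1 (@to_LinnM T)).
    by move=> _ _ [g _ <-] [h _ <-]; exists (g / h); rewrite // to_LinnM to_LinnV.
  exists (Linn_fun a^-1 g) => //.
  by rewrite -conj_to_Linn invgK /conjg mulgA.
- move=> L1; apply: T_simple.1; apply/seteqP; split=> // g _.
  apply: to_Linn_inj; rewrite (morphism1 (@to_LinnM T)).
  by have : range (@to_Linn T) (to_Linn g) by []; rewrite L1.
- by move=> LT; have [a] := range_to_Linn_proper; rewrite LT; apply.
Qed.

(** * The q-adic coordinates on the stabiliser of the first member *)

Section PadicCoordinates.
Variables (p d : nat) (psi : T -> 'rV[int]_d).
Hypothesis p_gt0 : (0 < p)%N.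
Hypothesis psiM : forall x y, center (H 0) x -> center (H 0) y ->
  psi (x * y) = (psi x + psi y)%R.
Hypothesis psi_surj : forall v, exists2 c, center (H 0) c & psi c = v.
Hypothesis psi_center : forall n c, center (H 0) c ->
  center (H n) c <-> forall i, (Posz (p ^ n)%N %| psi c ord0 i)%Z.
Local Notation index := ({q : prime_number | val q %| p} * 'I_d)%type.
Implicit Types z w zw : padic_product p d.

Lemma psi_quotient n c c' : center (H 0) c -> center (H 0) c' ->
  center (H n) (c^-1 * c') <->
  forall i, (Posz (p ^ n)%N %| psi c' ord0 i - psi c ord0 i)%Z%R.
Proof.
move=> Zc Zc'; have Zcc' : center (H 0) (c^-1 * c').
  have sZ := center_is_subgroup (H_subgroup 0).
  exact: is_subgroupM sZ (is_subgroupV sZ Zc) Zc'.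
have E i : (psi (c^-1 * c') ord0 i = psi c' ord0 i - psi c ord0 i)%R.
  by rewrite -[c' in RHS](mulVKg c) (psiM Zc Zcc') mxE addrAC subrr add0r.
split=> [/psi_center h i|h]; first by rewrite -E; exact: h.
by apply/psi_center => // i; rewrite E.
Qed.

(** Approximants of a at depth n; they are well defined modulo Z(H n). *)
Definition approx n a c :=
  center (H 0) c /\ forall x, H n x -> Linn_fun a x = c * x * c^-1.

Definition close n z c := forall i : index,
  (Posz (val (val i.1) ^ n)%N %| psi c ord0 i.2 - Posz (residue (z i) n))%Z%R.

(** The graph of the isomorphism from stab 0 to the product of the Z_q^d.
    Working with the relation rather than with a function makes both directions
    of the isomorphism symmetric: each is an existence and a uniqueness
    statement. *)
Definition coordinates a z :=
  stab 0 a /\ forall n, exists2 c, approx n a c & close n z c.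

Lemma approx_le m n a c : (m <= n)%N -> approx n a c -> approx m a c.
Proof. by move=> mn [Zc aE]; split=> // x Hx; apply: aE; exact: H_le Hx. Qed.

Lemma approx_eq n a c c' : approx n a c -> approx n a c' ->
  center (H n) (c^-1 * c').
Proof.
move=> [Zc aE] [Zc' aE']; apply/stab_to_Linn; rewrite to_LinnM to_LinnV.
by apply/coset_stab => x Hx; rewrite !Linn_fun_to_Linn -aE // -aE'.
Qed.

Lemma center_conj_eq n c c' x : center (H n) (c^-1 * c') -> H n x ->
  c * x * c^-1 = c' * x * c'^-1.
Proof.
move=> zZ; have [z [_ zC] ->] : exists2 z, center (H n) z & c' = c * z.
  by exists (c^-1 * c'); rewrite ?mulVKg.
by move=> Hx; rewrite -[c * z * x]mulgA zC // invgM !mulgA mulgK.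
Qed.

Lemma close_le m n z c : (m <= n)%N -> close n z c -> close m z c.
Proof.
move=> mn cz i; set q := val (val i.1).
apply: (dvdz_sub_trans (y := Posz (residue (z i) n))).
  by apply: dvdz_trans (cz i); rewrite dvdzE /= dvdn_exp2l.
by rewrite dvdz_subn; apply/eqP; exact: residue_mod.
Qed.

Lemma dvdn_index (i : index) n : (Posz (val (val i.1) ^ n)%N %| Posz (p ^ n)%N)%Z.
Proof. by rewrite dvdzE /=; apply: dvdn_exp2r; exact: (valP i.1). Qed.

(** Approximants at depth n differ by a multiple of p^n, hence of q^n. *)
Lemma coordinates_close n a z c : coordinates a z -> approx n a c -> close n z c.
Proof.
move=> [_ /(_ n)[c' ac' cz'] ] ac i; apply: dvdz_sub_trans (cz' i).
apply: dvdz_trans (dvdn_index i n) _.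
by have /psi_quotient := approx_eq ac' ac; apply; [case: ac' | case: ac].
Qed.

(** The q-adic residues must be known to depth n p, not only n, to recover an
    element modulo Z(H n): see [dvdn_exp_primes]. *)
Lemma padic_separate n c c' : center (H 0) c -> center (H 0) c' ->
  (forall i : index, (Posz (val (val i.1) ^ (n * p))%N %|
     psi c' ord0 i.2 - psi c ord0 i.2)%Z%R) ->
  center (H n) (c^-1 * c').
Proof.
move=> Zc Zc' cc; apply/psi_quotient => // j.
rewrite dvdzE /=; apply: dvdn_exp_primes => // q pq qp.
pose Q : {q : prime_number | val q %| p} :=
  exist _ (exist (fun k => prime k) q pq : prime_number) qp.
exact: (cc (Q, j)).
Qed.

(** Injectivity of the coordinates together with continuity of the inverse: the
    residues at depth n p determine the automorphism on H n. *)
Lemma coordinates_agree n a b z w : coordinates a z -> coordinates b w ->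
  (forall i, residue (z i) (n * p) = residue (w i) (n * p)) ->
  forall x, H n x -> Linn_fun a x = Linn_fun b x.
Proof.
move=> az bw zw; have np : (n <= n * p)%N by exact: leq_pmulr.
have [c ac cz] := az.2 (n * p)%N; have [c' bc' cw] := bw.2 (n * p)%N.
move=> x Hx; have [[Zc aE] [Zc' bE]] := (approx_le np ac, approx_le np bc').
rewrite aE // bE //; apply: center_conj_eq Hx; apply: padic_separate => // i.
apply: dvdz_sub_trans (cw i) _; rewrite -zw dvdz_sub_sym; exact: cz.
Qed.

(** Successive approximants agree modulo p^n, so their coordinates converge in
    each Z_q. *)
Lemma coordinates_exist a : stab 0 a -> exists z, coordinates a z.
Proof.
move=> aS.
have /choice[c cP] n : exists c, approx n a c.
  by have [c Zc cP] := stab_approx n aS; exists c.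
have cc (i : index) n :
    (Posz (val (val i.1) ^ n)%N %| psi (c n.+1) ord0 i.2 - psi (c n) ord0 i.2)%Z%R.
  apply: dvdz_trans (dvdn_index i n) _.
  have /psi_quotient := approx_eq (cP n) (approx_le (leqnSn n) (cP n.+1)).
  by apply; [exact: (cP n).1 | exact: (cP n.+1).1].
have zP (i : index) := padic_of_int (cc i).
pose z : padic_product p d := fun i => projT1 (cid (zP i)).
exists z; split=> // n; exists (c n) => // i.
exact: (projT2 (cid (zP i)) n).
Qed.

Lemma coordinates_inj a z w : coordinates a z -> coordinates a w -> z = w.
Proof.
move=> az aw; apply: functional_extensionality_dep => i.
have /choice[c cP] n : exists c, approx n a c by have [c] := az.2 n; exists c.
apply: (@padic_close_eq _ _ _ (fun n => psi (c n) ord0 i.2)) => n.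
  exact: coordinates_close az (cP n) i.
exact: coordinates_close aw (cP n) i.
Qed.

Lemma close_exists n z : exists2 c, center (H 0) c & close n z c.
Proof.
(* The residues as a function of a bare natural number, with value 0 where it
   is not a prime divisor of p, as the Chinese remainder lemma requires. *)
have rP k : exists r : 'I_d -> nat, forall i : index, val (val i.1) = k ->
    residue (z i) n = r i.2.
  have [[Q Qk]|noQ] := pselect (exists Q : {q : prime_number | val q %| p},
    val (val Q) = k); last by exists (fun=> 0%N) => -[Q j] /= Qk; case: noQ; exists Q.
  exists (fun j => residue (z (Q, j)) n) => -[Q' j] /= Q'k.
  suff -> : Q' = Q by [].
  by do 2!apply: val_inj; exact: etrans Q'k (esym Qk).
have [r rE] := choice rP.
have mP (j : 'I_d) : exists m, forall q, q \in primes p -> m = r q j %[mod q ^ n].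
  apply: crt_primes; first exact: primes_uniq.
  by apply/allP => q; rewrite mem_primes => /and3P[].
have [m mE] := choice mP.
(* The integers m j have the prescribed residues at all primes dividing p. *)
have [c Zc cE] := psi_surj (\row_j Posz (m j))%R.
exists c => // i; rewrite cE mxE dvdz_subn (rE _ i erefl); apply/eqP/mE.
by rewrite mem_primes p_gt0 (valP (val i.1)) (valP i.1).
Qed.

(** The integers provided by the Chinese remainder theorem at the depths n p
    form a sequence that [limit_conj] turns into an automorphism. *)
Lemma coordinates_surj z : exists a, coordinates a z.
Proof.
have /choice[c cP] n : exists c, center (H 0) c /\ close (n * p) z c.
  by have [c Zc cz] := close_exists (n * p) z; exists c.
have cc n : center (H n) ((c n)^-1 * c n.+1).
  apply: padic_separate; [exact: (cP n).1 | exact: (cP n.+1).1 | move=> i].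
  have le : (n * p <= n.+1 * p)%N by rewrite leq_mul2r leqnSn orbT.
  apply: (dvdz_sub_trans (close_le le (cP n.+1).2 i)).
  by rewrite dvdz_sub_sym; exact: (cP n).2.
have [|a aE] := limit_conj _ cc; first by move=> n; exact: center_sub (cP n).1.
exists a; split=> [x Hx|n].
  by rewrite (aE 0%N) //; apply/conj_fixP; exact: (cP 0%N).1.2.
exists (c n); first by split; [exact: (cP n).1 | exact: aE].
by apply: close_le (cP n).2; exact: leq_pmulr.
Qed.

Lemma coordinatesM a b z w zw : coordinates a z -> coordinates b w ->
  coordinates (a * b) zw -> forall i, zw i = (z i + w i)%R.
Proof.
move=> az bw aby i.
have /choice[c cP] n : exists c, approx n a c by have [c] := az.2 n; exists c.
have /choice[c' cP'] n : exists c, approx n b c by have [k] := bw.2 n; exists k.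
have abP n : approx n (a * b) (c n * c' n).
  have [[Zc aE] [Zc' bE]] := (cP n, cP' n); split.
    exact: is_subgroupM (center_is_subgroup (H_subgroup 0)) Zc Zc'.
  move=> x Hx; rewrite Linn_funM bE // aE; last first.
    have Hc' : H n (c' n) by apply: H_le (leq0n n) (center_sub Zc').
    by apply: (H_subgroup n).2 => //; exact: is_subgroupM.
  by rewrite invgM !mulgA.
apply: (@padic_close_eq _ _ _ (fun n => psi (c n * c' n) ord0 i.2)) => n.
  exact: coordinates_close aby (abP n) i.
have -> : residue (z i + w i)%R n =
  (residue (z i) n + residue (w i) n) %% val (val i.1) ^ n by [].
rewrite (psiM (cP n).1 (cP' n).1) mxE.
apply: (dvdz_sub_trans (y := (Posz (residue (z i) n) + Posz (residue (w i) n))%R)).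
  rewrite opprD addrACA rpredD //; first exact: coordinates_close az (cP n) i.
  exact: coordinates_close bw (cP' n) i.
by rewrite -PoszD dvdz_subn modn_mod.
Qed.

(** The inverse of the coordinate map is continuous and defined on a compact
    space, which gives compactness of stab 0. *)
Lemma stab_isomorphic_padic_product :
  compact (stab 0) /\ isomorphic_to_padic_product (stab 0) p d.
Proof.
have /choice[f fP] a : exists z, stab 0 a -> coordinates a z.
  have [/coordinates_exist[z az]|na] := pselect (stab 0 a); first by exists z.
  by exists (fun=> 0%R).
have /choice[g gP] := coordinates_surj.
have gf a : stab 0 a -> g (f a) = a.
  move=> /fP af; apply: Linn_eqP => x; have [n Hx] := H_union x.
  exact: coordinates_agree (gP _) af _ _ Hx.
have cg : continuous g.
  move=> z; apply: (Linn_cvgP _ (fmap_filter _ (nbhs_filter z))).2 => x.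
  have [n Hx] := H_union x.
  apply: (@filterS _ _ (nbhs_filter z) _ _ _ (padic_product_near z (n * p) p_gt0)).
  move=> w wz.
  exact: coordinates_agree (gP w) (gP z) wz _ Hx.
have gS z : stab 0 (g z) by exact: (gP z).1.
split.
  have -> : stab 0 = g @` setT.
    by apply/seteqP; split=> [a /gf <-|_ [z _ <-]]; [exists (f a) | exact: gS].
  apply: continuous_compact; last exact: padic_product_compact.
  exact: continuous_subspaceT.
exists f, g; split=> //.
- by move=> z; split=> //; apply: coordinates_inj (gP z); exact: fP.
- move=> a b i Sa Sb; apply: coordinatesM (fP _ Sa) (fP _ Sb) _ _.
  by apply: fP; exact: is_subgroupM (stab_subgroup 0) Sa Sb.
apply/subspace_continuousP => a Sa; apply: padic_product_cvgP => i n.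
have ab : nbhs a [set b | forall x, H n x -> Linn_fun b x = Linn_fun a x].
  exact: Linn_near.
rewrite /within /fmap /=; apply: filterS ab => b ba Sb.
have [c ac cz] := (fP _ Sa).2 n.
have bc : approx n b c by split=> [|x Hx]; [exact: ac.1 | rewrite ba //; exact: ac.2].
have := coordinates_close (fP _ Sb) bc i; rewrite dvdz_sub_sym => bz.
have := dvdz_sub_trans bz (cz i); rewrite dvdz_subn => /eqP.
by rewrite !modn_small // ltn_residue.
Qed.

End PadicCoordinates.

(** * Local compactness and non-discreteness *)

(** Every point has a translate of stab 0 as a compact neighbourhood. *)
Lemma Linn_locally_compact :
  compact (stab 0) -> locally_compact [set: Linn T].
Proof.
move=> cS a _; exists [set b | stab 0 (a^-1 * b)]; last split.
- rewrite /within /=; apply: filterS (Linn_near a 0) => b ab _.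
  exact/coset_stab.
- have -> : [set b | stab 0 (a^-1 * b)] = (fun b => a * b) @` stab 0.
    apply/seteqP; split=> [b ab|_ [u uS <-]]; last by rewrite /= mulKg.
    by exists (a^-1 * b); rewrite ?mulVKg.
  apply: continuous_compact cS; apply: continuous_subspaceT => b.
  apply: (Linn_cvgP _ (fmap_filter _ (nbhs_filter b))).2 => x.
  apply: (@filterS _ _ (nbhs_filter b) _ _ _ (Linn_near_seq b [:: x])) => c.
  by move=> /(_ x (mem_head _ _)) cx; exact: congr1 cx.
- apply: (@coset_union_clopen 0 _ _).2 => b u bS uS /=.
  by rewrite mulgA; exact: is_subgroupM (stab_subgroup 0) bS uS.
Qed.

(** No stab n is trivial, because it contains the image of Z(H n), which is not
    trivial and on which conjugation is faithful. *)
Lemma Linn_not_discrete : ~ discrete_space (Linn T).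
Proof.
move=> /(_ [set 1]); rewrite openE => /(_ 1 erefl) /stab_nbhsP[n nS].
have [c Zc ncZ] := center_strict n; apply: ncZ.
have : stab n (to_Linn c) by exact/stab_to_Linn.
move=> /nS; rewrite mul1g -(morphism1 (@to_LinnM T)) => /to_Linn_inj ->.
exact: is_subgroup1 (center_is_subgroup (H_subgroup _)).
Qed.

End Centralizers.
End ChainTopology.

(** * The centers of the given chain, and the conclusion *)

(** A simple group is non-trivial by definition, so the quotient by the center
    is not trivial. *)
Lemma simple_mod_center_nonabelian (K : groupType) (A : subgroup K) :
  simple_group (quotient_group (center_group A)) -> center A <> A.
Proof.
move=> [Q1 _] AZ; apply: Q1; apply/seteqP; split=> // X _.
elim/quotient_ind: X => x; apply/quotient_piP => /=; split=> // y _.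
rewrite mulg1; apply: commute_sym; apply: commuteV.
apply: val_inj => /=.
have : center A (sval y) by rewrite AZ; exact: set_mem (svalP y).
by case=> _; apply; exact: set_mem (svalP x).
Qed.

(** Each Z (n+1) consists of the p-th powers in Z n, so Z n consists of the
    p^n-th powers in Z 0, and psi 0 turns powers into multiples. *)
Lemma center_chain_divisible (T : groupType) (Z : nat -> set T) (d p : nat)
    (psi : nat -> T -> 'rV[int]_d) :
  (forall n, is_subgroup (Z n)) ->
  (forall n, (forall x y, Z n x -> Z n y ->
      psi n (x * y) = (psi n x + psi n y)%R) /\
    set_bij (Z n) [set: 'rV[int]_d] (psi n)) ->
  (forall n, Z n.+1 `<=` Z n /\
    psi n @` Z n.+1 = range (fun v : 'rV[int]_d => (v *+ p)%R)) ->
  forall n c, Z 0 c -> Z n c <-> forall i, (Posz (p ^ n)%N %| psi 0%N c ord0 i)%Z.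
Proof.
move=> sZ psi_iso Z_next.
have ZX n x k : Z n x -> Z n (x ^+ k).
  move=> Zx; elim: k => [|k IHk]; first exact: is_subgroup1 (sZ n).
  by rewrite expgS; exact: is_subgroupM.
have psiX n x k : Z n x -> psi n (x ^+ k) = (psi n x *+ k)%R.
  move=> Zx; elim: k => [|k IHk]; last first.
    by rewrite expgS mulrS (psi_iso n).1 ?IHk //; exact: ZX.
  have Z1 := is_subgroup1 (sZ n); apply: (addrI (psi n 1)).
  by rewrite -(psi_iso n).1 // mulg1 mulr0n addr0.
have next n x : Z n.+1 x <-> exists2 y, Z n y & x = y ^+ p.
  have [ZZ pZ] := Z_next n; have [_ [_ inj surj]] := psi_iso n.
  split=> [Zx|[y Zy ->]].
    have : (psi n @` Z n.+1) (psi n x) by exists x.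
    rewrite pZ => -[v _ vx]; have [y Zy yv] := surj v I; exists y => //.
    by apply: inj; rewrite ?inE ?psiX ?yv //; [exact: ZZ | exact: ZX].
  have : (psi n @` Z n.+1) (psi n (y ^+ p)).
    by rewrite pZ psiX //; exists (psi n y).
  case=> z Zz zy; suff <- : z = y ^+ p by [].
  by apply: inj; rewrite ?inE //; [exact: ZZ | exact: ZX].
have powers n x : Z n x <-> exists2 y, Z 0 y & x = y ^+ (p ^ n)%N.
  elim: n x => [|n IHn] x.
    by split=> [Zx|[y Zy ->]]; [exists x; rewrite ?expg1 | rewrite expg1].
  split=> [/next[y /IHn[z Zz ->] ->]|[y Zy ->]].
    by exists z; rewrite // -expgnA -expnSr.
  apply/next; exists (y ^+ (p ^ n)%N); last by rewrite -expgnA -expnSr.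
  by apply/IHn; exists y.
move=> n c Zc; split=> [/powers[y Zy ->] i|h].
  by rewrite psiX // mulmxnE -mulr_natr dvdz_mull // natz.
have /choice[v vE] : forall i, exists k : int, psi 0%N c ord0 i = (k *+ (p ^ n)%N)%R.
  by move=> i; have /dvdzP[k kE] := h i; exists k; rewrite kE -mulr_natr natz.
have [_ [_ inj surj]] := psi_iso 0%N.
have [y Zy yE] := surj (\row_i v i)%R I.
apply/powers; exists y => //.
apply: inj; rewrite ?inE //; first exact: ZX.
by rewrite psiX // yE; apply/rowP => i; rewrite mulmxnE mxE -vE.
Qed.

Theorem theorem4p6 (d p : nat) (T : groupType) (R : subgroup T)
  (G : nat -> subgroup T) (psi : nat -> T -> 'rV[int]_d)
  (d_ge1 : (1 <= d)%N) (p_ge2 : (2 <= p)%N)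
  (R_countable : countable R)
  (G_chain : forall n, (1 <= n)%N -> G n `<=` G n.+1)
  (G_fg_perfect : forall n, (1 <= n)%N ->
     finitely_generated (G n) /\ perfect (G n))
  (G_mod_center_simple : forall n, (1 <= n)%N ->
     simple_group (quotient_group (center_group (G n))))
  (psi_iso : forall n, (1 <= n)%N ->
     (forall x y, center (G n) x -> center (G n) y ->
        psi n (x * y) = (psi n x + psi n y)%R) /\
     set_bij (center (G n)) [set: 'rV[int]_d] (psi n))
  (G_center_next : forall n, (1 <= n)%N ->
     center (G n.+1) `<=` center (G n) /\
     psi n @` center (G n.+1) = range (fun v : 'rV[int]_d => (v *+ p)%R))
  (G_centralizer : forall n, (1 <= n)%N ->
     centralizer (G n) (G 1%N) = center (G 1%N))
  (R_sub : R `<=` G 1%N)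
  (R_center : R `&` center (G 1%N) = [set 1])
  (G_torsion_free : forall n, (1 <= n)%N -> torsion_free R -> torsion_free (G n))
  (G_union : \bigcup_(n in [set n | (1 <= n)%N]) (G n : set T) = [set: T])
  (T_simple : simple_group T) :
  (* (i) *)
  [/\ ~ (forall x y : Linn T, commute x y),
      locally_compact [set: Linn T],
      totally_disconnected [set: Linn T],
      ~ discrete_space (Linn T) &
      topologically_simple (Linn T)] /\
  (* (ii) *)
  (~ simple_group (Linn T) /\
   forall N : set (Linn T), is_normal_subgroup N -> N <> [set 1] ->
     range (@to_Linn T) `<=` N) /\
  (* (iii) *)
  (let A := closure (@to_Linn T @` center (G 1%N)) in
   [/\ is_subgroup A, compact A, open A & isomorphic_to_padic_product A p d]) /\
  (* (iv) *)
  (set_inj R (@to_Linn T) /\ discrete_space (set_type (@to_Linn T @` R))) /\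
  (* (v) *)
  (@second_countable (Linn T) /\ ~ compactly_generated (Linn T)) /\
  (* (vi) *)
  (forall n, (1 <= n)%N ->
     open (closure (@to_Linn T @` center (G n))) /\
     closure (@to_Linn T @` center (G n)) =
       centralizer [set: Linn T] (@to_Linn T @` G n)) /\
  (* (vii) *)
  (forall (m : nat) (F : topologicalFieldType), (1 <= m)%N ->
     hausdorff_space F ->
     forall f : Linn T -> 'M[F]_m,
       (forall x, f x \in unitmx) ->
       (forall x y, f (x * y) = (f x *m f y)%R) ->
       continuous f ->
       forall x, f x = 1%:M%R) /\
  (* (viii) *)
  (forall H : subgroup (Linn T), finitely_generated H -> centerless H ->
     discrete_space H) /\
  (* (ix) *)
  countable [set C : set (subgroup (Linn T)) |
    exists H : subgroup (Linn T), [/\ finitely_generated H, centerless H &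
      C = [set K : subgroup (Linn T) | [/\ finitely_generated K,
             centerless K & isomorphic H K]]]].
Proof.
pose H n : set T := G n.+1.
have H_sub n : is_subgroup (H n) by exact: subgroupP.
have H_succ n : H n `<=` H n.+1 by exact: G_chain.
have H_fg n : finitely_generated (H n) by have [] := G_fg_perfect n.+1 isT.
have H_union x : exists n, H n x.
  have : (\bigcup_(n in [set n | (1 <= n)%N]) (G n : set T)) x by rewrite G_union.
  by case=> -[//|n] _ nx; exists n.
have H_nonabelian n : center (H n) <> H n.
  exact: simple_mod_center_nonabelian (G_mod_center_simple n.+1 isT).
have H_centralizer n : centralizer setT (H n) = center (H n).
  apply/seteqP; split=> x [Hx xC]; split=> //.
  (* An element of T that centralizes H n centralizes H 0, hence lies in
     Z(H 0), which is contained in H n. *)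
  have [k Hk] := H_union x.
  suff : center (H 0) x by case=> Hx0 _; exact:
    (@chain_le T H H_succ 0%N n (leq0n n) x Hx0).
  rewrite -[center (H 0)](G_centralizer k.+1 isT); split=> // y Hy; apply: xC.
  exact: (@chain_le T H H_succ 0%N n (leq0n n) y Hy).
have T_nonabelian : center [set: T] <> setT.
  move=> TZ; apply: (H_nonabelian 0%N); apply/seteqP; split=> [x []//|x Hx].
  split=> // y _; have : center setT x by rewrite TZ.
  by case=> _; apply.
have T_centerless : centerless [set: T].
  by have [//|] := T_simple.2 _ (center_normal T).
pose psi0 := psi 1%N.
have psiM x y : center (H 0) x -> center (H 0) y -> psi0 (x * y) = (psi0 x + psi0 y)%R.
  exact: (psi_iso 1%N isT).1.
have psi_surj v : exists2 c, center (H 0) c & psi0 c = v.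
  by have [_ [_ _ /(_ v I)[c Zc cv]]] := psi_iso 1%N isT; exists c.
have p_gt0 : (0 < p)%N by exact: ltnW.
have psi_center n c : center (H 0) c ->
    center (H n) c <-> forall i, (Posz (p ^ n)%N %| psi0 c ord0 i)%Z.
  apply: (@center_chain_divisible T (fun n => center (H n)) d p (psi \o succn)).
  - by move=> m; exact: center_is_subgroup.
  - by move=> m; exact: psi_iso.
  - by move=> m; exact: G_center_next.
have center_strict n : exists2 c, center (H n) c & ~ center (H n.+1) c.
  (* The vector with all entries p^n is divisible by p^n but not by p^(n+1). *)
  have [c Zc cE] := psi_surj (const_mx (Posz (p ^ n)%N)).
  exists c; first by apply/psi_center => // i; rewrite cE mxE.
  move=> /(psi_center _ _ Zc)/(_ (Ordinal d_ge1)); rewrite cE mxE dvdzE /=.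
  by rewrite dvdn_Pexp2l // ltnn.
have [cS isoS] : compact (stab H 0) /\ isomorphic_to_padic_product (stab H 0) p d.
  exact: (@stab_isomorphic_padic_product _ _ _ _ _ _ _ p d psi0).
have inj := to_Linn_inj T_centerless.
have S0 n : closure (@to_Linn T @` center (H n)) = stab H n by exact: stab_closure.
have openS n : open (stab H n) by apply: (@stab_clopen _ H _ _ _ _).1.
split.
  split.
  - move=> LC; apply: T_nonabelian; apply/seteqP; split=> // x _; split=> // y _.
    by apply: inj; rewrite !to_LinnM; exact: LC.
  - exact: (@Linn_locally_compact _ H).
  - by apply: zero_dimension_totally_disconnected; exact: (@Linn_zero_dimensional _ H).
  - exact: (@Linn_not_discrete _ H).
  - exact: (@Linn_topologically_simple _ H).
split.
  split; first exact: (@Linn_not_simple _ H).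
  by move=> N; exact: normal_contains_inner.
split.
  rewrite /= (S0 0%N); split=> //; exact: stab_subgroup.
split.
  split; first by move=> x y _ _; exact: inj.
  by apply: (@to_Linn_discrete _ H) => //; exact: subgroupP.
split.
  split; first exact: (@Linn_second_countable _ H).
  exact: (@Linn_not_compactly_generated _ H).
split.
  move=> [//|n] _; rewrite (S0 n); split=> //; exact: stab_centralizer.
split.
  move=> m F _ hF f fU fM cf; exact: (@Linn_linear_trivial _ H).
split; first exact: (@fg_centerless_discrete _ H).
exact: (@countable_fg_centerless_classes _ H).
Qed.
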